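(* Let $p,q\in[1,\infty]$, and let $(E,\tau)$ be a locally convex space. Then: (i) every $(p,q)$-limited set in $E$ is $(p,q)$-$\mathcal{E}$-limited; the converse is true if $E$ is a $p$-barrelled space; (ii) every $(p,q)$-$\mathcal{E}$-limited set in $E$ is bounded; (iii) the family of all $(p,q)$-limited (resp., $(p,q)$-$\mathcal{E}$-limited) sets in $E$ is closed under taking (non-empty) subsets, finite unions and sums, and closed absolutely convex hulls; (iv) the family of $(p,q)$-limited (resp., $(p,q)$-$\mathcal{E}$-limited) sets is closed under taking continuous linear images (i.e. if $T:E\to L$ is a continuous linear map into a locally convex space $L$ and $A\subseteq E$ is of the given type in $E$, then $T(A)$ is of the same type in $L$); in particular, if $H$ is a subspace of $E$, then every $(p,q)$-limited (resp., $(p,q)$-$\mathcal{E}$-limited) set in $H$ is $(p,q)$-limited (resp., $(p,q)$-$\mathcal{E}$-limited) in $E$; (v) a subset $A$ of $E$ is a $(p,q)$-limited (resp., $(p,q)$-$\mathcal{E}$-limited) set if and only if every countable subset of $A$ is a $(p,q)$-limited (resp., $(p,q)$-$\mathcal{E}$-limited) set; (vi) if $p',q'\in[1,\infty]$ are such that $p'\leq p$ and $q\leq q'$, then every $(p,q)$-limited (resp., $(p,q)$-$\mathcal{E}$-limited) set in $E$ is also $(p',q')$-limited (resp., $(p',q')$-$\mathcal{E}$-limited); in particular, any $(p,q)$-limited (resp., $(p,q)$-$\mathcal{E}$-limited) set is $(1,\infty)$-limited (resp., $(1,\infty)$-$\mathcal{E}$-limited); (vii) the property of being a $(p,q)$-limited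 set depends only on the duality $(E,E')$, i.e., if $\mathcal{T}$ is a locally convex vector topology on $E$ compatible with the topology $\tau$ of $E$, then the $(p,q)$-limited sets of $(E,\mathcal{T})$ are exactly the $(p,q)$-limited sets of $(E,\tau)$; (viii) every $(p,q)$-limited (resp., $(p,q)$-$\mathcal{E}$-limited) set in $E$ is a $(p,q)$-$(V^\ast)$ (resp., $(p,q)$-$(EV^\ast)$) set; the converse is true for semi-reflexive spaces; (ix) every $(p,q)$-limited subset of $E'_\beta$ is a $(p,q)$-$(V)$ set; (x) if $q<p$ and $A$ is a $(p,q)$-$\mathcal{E}$-limited subset of $E$, then $A=\{0\}$; (xi) if $q\geq p$, then any (non-empty) finite subset of $E$ is $(p,q)$-limited; (xii) a bounded subset $A$ of $E$ is $(p,q)$-limited (resp., $(p,q)$-$\mathcal{E}$-limited) if and only if for every sequence $\{x_n\}_{n\in\omega}$ in $A$ and each (resp., equicontinuous) weak$^\ast$ $p$-summable sequence $\{\chi_n\}_{n\in\omega}$ in $E'$, it follows that $\big(|\langle \chi_n, x_n\rangle|\big)_{n\in\omega}\in \ell_q$ (or $\in c_0$ if $q=\infty$).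
   Context: All locally convex spaces (lcs) are Hausdorff, over $\mathbb{F}\in\{\mathbb{R},\mathbb{C}\}$; $\omega=\{0,1,2,\dots\}$. $E'$ is the topological dual of $E$; $E'_{w^\ast}=(E',\sigma(E',E))$; $E'_\beta=(E',\beta(E',E))$ is the strong dual. For $A\subseteq E$ and $\chi\in E'$, $\|\chi\|_A:=\sup\{|\chi(x)|:x\in A\cup\{0\}\}$. A sequence $\{x_n\}_{n\in\omega}$ in an lcs $F$ is weakly $p$-summable if for every $\chi\in F'$ one has $(\langle\chi,x_n\rangle)_n\in\ell_p$ if $p<\infty$, and $(\langle\chi,x_n\rangle)_n\in c_0$ if $p=\infty$. A sequence $\{\chi_n\}$ in $E'$ is weak$^\ast$ $p$-summable if it is weakly $p$-summable in $E'_{w^\ast}$, i.e. $(\langle\chi_n,x\rangle)_n\in\ell_p$ (or $c_0$ if $p=\infty$) for every $x\in E$. A non-empty subset $A$ of $E$ is $(p,q)$-limited (resp., $(p,q)$-$\mathcal{E}$-limited) if $(\|\chi_n\|_A)_n\in\ell_q$ if $q<\infty$, or $\|\chi_n\|_A\to0$ if $q=\infty$, for every (resp., every equicontinuous) weak$^\ast$ $p$-summable sequence $\{\chi_n\}$ in $E'$. A non-empty subset $A$ of $E$ is a $(p,q)$-$(V^\ast)$ set (resp., a $(p,q)$-$(EV^\ast)$ set) if $\big(\sup_{a\in A}|\langle\chi_n,a\rangle|\big)_n\in\ell_q$ (or $\in c_0$ if $q=\infty$) for every (resp., every equicontinuous) weakly $p$-summable sequence $\{\chi_n\}$ in $E'_\beta$.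 A non-empty subset $B$ of $E'$ is a $(p,q)$-$(V)$ set if $\big(\sup_{\chi\in B}|\langle\chi,x_n\rangle|\big)_n\in\ell_q$ (or $\in c_0$ if $q=\infty$) for every weakly $p$-summable sequence $\{x_n\}$ in $E$. $E$ is $p$-barrelled if every weakly $p$-summable sequence in $E'_{w^\ast}$ is equicontinuous. Two vector topologies on the same vector space are compatible if they have the same topological dual (algebraically). $E$ is semi-reflexive if the canonical map $E\to(E'_\beta)'$ is an algebraic isomorphism. *)

(* Defs.v *)
From HB Require Import structures.
From mathcomp Require Import all_boot all_order all_algebra.
From mathcomp Require Import complex.
From mathcomp Require Import all_classical all_reals all_analysis.

Set Implicit Arguments.
Unset Strict Implicit.
Unset Printing Implicit Defensive.

Import Order.TTheory GRing.Theory Num.Def Num.Theory.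
Import numFieldNormedType.Exports.

Local Open Scope classical_set_scope.
Local Open Scope ring_scope.

(* A [tvsType K] of the library is locally convex but not assumed Hausdorff. *)

Section Dual.
Context {K : numFieldType} (E : tvsType K).

Definition continuous_linear : {pred E -> K^o} :=
  fun f => `[< linear f /\ continuous (f : E -> K^o) >].

Lemma continuous_linear_submod : submod_closed continuous_linear.
Proof.
split.
  apply/asboolP; split; first by move=> a x y; rewrite /= /cst scaler0 addr0.
  exact: cst_continuous.
move=> a f g /asboolP[lf cf] /asboolP[lg cg]; apply/asboolP; split.
  move=> b x y.
  change (a *: f (b *: x + y) + g (b *: x + y) =
    b *: (a *: f x + g x) + (a *: f y + g y)).
  by rewrite lf lg !scalerDr addrACA !scalerA [a * b]mulrC.
move=> x; apply: cvgD; last exact: cg.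
by apply: cvgZr; exact: cf.
Qed.

HB.instance Definition _ :=
  GRing.isSubmodClosed.Build K (E -> K^o) continuous_linear
    continuous_linear_submod.

Record dual := Dual {
  dual_fun :> E -> K^o;
  _ : dual_fun \in continuous_linear }.

HB.instance Definition _ := [isSub for dual_fun].
HB.instance Definition _ := [Choice of dual by <:].
HB.instance Definition _ := [SubChoice_isSubLmodule of dual by <:].

Lemma dual_linear (f : dual) : linear (f : E -> K^o).
Proof. by have /asboolP[] := valP f. Qed.

Lemma dual_continuous (f : dual) : continuous (f : E -> K^o).
Proof. by have /asboolP[] := valP f. Qed.

End Dual.

HB.instance Definition _ (K : numFieldType) (E : tvsType K) (f : dual E) :=
  GRing.isLinear.Build K E K^o _ (dual_fun f) (dual_linear f).

Section StrongDual.
Context {K : numFieldType}.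

Definition tvs_bounded (E : tvsType K) (A : set E) :=
  forall U : set E, nbhs 0 U ->
    exists2 r : K, 0 < r & forall s : K, r <= `|s| -> A `<=` ( *:%R s) @` U.

Variable E : tvsType K.

Definition strong_dual := dual E.

HB.instance Definition _ := GRing.Lmodule.on strong_dual.

Definition strong_ball (f : strong_dual) (Be : set E * K) : set strong_dual :=
  [set g | forall x, Be.1 x -> `|f x - g x| < Be.2].

Definition strong_nbhs (f : strong_dual) : set_system strong_dual :=
  filter_from [set Be : set E * K | tvs_bounded Be.1 /\ 0 < Be.2]
    (strong_ball f).

HB.instance Definition _ := hasNbhs.Build strong_dual strong_nbhs.

Lemma tvs_bounded0 : tvs_bounded (set0 : set E).
Proof. by move=> U _; exists 1 => // s _ x. Qed.

Lemma tvs_boundedU (A B : set E) :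
  tvs_bounded A -> tvs_bounded B -> tvs_bounded (A `|` B).
Proof.
move=> bA bB U U0; have [r r0 Ar] := bA U U0; have [s s0 Bs] := bB U U0.
exists (r + s); first exact: addr_gt0.
move=> t rst x [Ax|Bx].
  by apply: Ar Ax; apply: le_trans rst; rewrite lerDl ltW.
by apply: Bs Bx; apply: le_trans rst; rewrite lerDr ltW.
Qed.

Lemma tvs_bounded1 (x : E) : tvs_bounded [set x].
Proof.
move=> U U0.
have := @scale_continuous K E (0, x) U; rewrite /= scale0r => /(_ U0).
move=> [[A B] [/= /nbhs_ballP[e /= e0 eA] Bx] ABU].
have eU (k : K) : ball (0 : K^o) e k -> U (k *: x).
  by move=> /eA Ak; apply: (ABU (k, x)); split=> //; exact: nbhs_singleton.
exists (e^-1 + e^-1); first by rewrite addr_gt0// invr_gt0.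
move=> s es _ ->.
have s0 : 0 < `|s| by apply: lt_le_trans es; rewrite addr_gt0// invr_gt0.
have s_neq0 : s != 0 by rewrite -normr_gt0.
exists (s^-1 *: x); last by rewrite scalerA divff// scale1r.
apply: (eU s^-1); rewrite -ball_normE /= sub0r normrN normfV.
rewrite invf_plt ?posrE//; apply: lt_le_trans es.
by rewrite ltrDl invr_gt0.
Qed.

Lemma dual_bounded (f : dual E) (A : set E) : tvs_bounded A ->
  exists2 M : K, 0 < M & forall x, A x -> `|f x| <= M.
Proof.
move=> bA.
have := @dual_continuous _ _ f 0 _ (nbhsx_ballx (f 0) 1 ltr01).
rewrite linear0 => U0.
have [r r0 Ar] := bA _ U0.
exists r => // x Ax.
have [] := Ar r _ x Ax; first by rewrite gtr0_norm.
move=> y; rewrite /= -ball_normE /= sub0r normrN => fy <-.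
by rewrite linearZ /= normrM gtr0_norm// ger_pMr// ltW.
Qed.

Lemma strong_nbhs_filter (f : strong_dual) : ProperFilter (nbhs f).
Proof.
apply: filter_from_proper; last first.
  by move=> [B e] [bB /= e0]; exists f => x _ /=; rewrite subrr normr0.
apply: filter_from_filter; first by exists (set0, 1); split=> //=; exact: tvs_bounded0.
move=> [B e] [C d] /= [bB e0] [bC d0].
have ed : exists2 m : K, 0 < m & m <= e /\ m <= d.
  exists (e * d / (e + d)); first by rewrite divr_gt0// ?mulr_gt0// addr_gt0.
  have ed0 : 0 < e + d by rewrite addr_gt0.
  rewrite !ler_pdivrMr// mulrDr mulrDr; split.
    by rewrite lerDr mulr_ge0// ltW.
  by rewrite [e * d]mulrC lerDl mulr_ge0// ltW.
have [m m0 [me md]] := ed.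
exists (B `|` C, m); first by split=> //=; exact: tvs_boundedU.
move=> g /= fg; split=> x /= Ax.
  by apply: lt_le_trans me; apply: fg; left.
by apply: lt_le_trans md; apply: fg; right.
Qed.

Lemma strong_nbhs_singleton (f : strong_dual) (A : set strong_dual) :
  nbhs f A -> A f.
Proof.
by move=> [[B e] [bB /= e0]]; apply => x _ /=; rewrite subrr normr0.
Qed.

Lemma strong_nbhs_nbhs (f : strong_dual) (A : set strong_dual) :
  nbhs f A -> nbhs f (nbhs^~ A).
Proof.
move=> [[B e] [bB /= e0] BA].
have e20 : 0 < e / 2 by rewrite divr_gt0.
exists (B, e / 2) => // g fg.
exists (B, e / 2) => // h gh; apply: BA => x /= Bx.
rewrite [e]splitr -(subrKA (g x)).
by apply: le_lt_trans (ler_normD _ _) _; apply: ltrD; [exact: fg|exact: gh].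
Qed.

HB.instance Definition _ := Nbhs_isNbhsTopological.Build strong_dual
  strong_nbhs_filter strong_nbhs_singleton strong_nbhs_nbhs.

Lemma strong_add_continuous :
  continuous (fun z : strong_dual * strong_dual => z.1 + z.2).
Proof.
move=> [f g] U /= [[B e] [bB /= e0] BU].
have e20 : 0 < e / 2 by rewrite divr_gt0.
exists (strong_ball f (B, e / 2), strong_ball g (B, e / 2)).
  by split; exists (B, e / 2).
move=> [h k] [/= fh gk]; apply: BU => x /= Bx.
change (`|f x + g x - (h x + k x)| < e).
rewrite [e]splitr opprD addrACA.
by apply: le_lt_trans (ler_normD _ _) _; apply: ltrD; [exact: fh|exact: gk].
Qed.

Lemma strong_scale_continuous :
  continuous (fun z : K^o * strong_dual => z.1 *: z.2).
Proof.
move=> [k f] U /= [[B e] [bB /= e0] BU].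
have [M M0 fM] := dual_bounded f bB.
have e20 : 0 < e / 2 by rewrite divr_gt0.
have k0 : 0 < `|k| + 1 by rewrite ltr_wpDl.
pose d := e / 2 / (`|k| + 1); have d0 : 0 < d by rewrite divr_gt0.
pose c := e / 2 / (M + d); have Md0 : 0 < M + d by rewrite addr_gt0.
have c0 : 0 < c by rewrite divr_gt0.
exists (ball (k : K^o) c, strong_ball f (B, d)).
  by split; [exact: nbhsx_ballx|exists (B, d)].
move=> [l g] [/=]; rewrite -ball_normE /= => kl fg; apply: BU => x /= Bx.
change (`|k * f x - l * g x| < e).
have -> : k * f x - l * g x = k * (f x - g x) + (k - l) * g x.
  by rewrite mulrBr mulrBl addrA subrK.
rewrite [e]splitr; apply: le_lt_trans (ler_normD _ _) _; rewrite !normrM.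
have gM : `|g x| <= M + d.
  rewrite -[g x](subKr (f x)); apply: le_trans (ler_normB _ _) _.
  by apply: lerD; [exact: fM|exact/ltW/fg].
have H1 : `|k| * `|f x - g x| < e / 2.
  have -> : e / 2 = (`|k| + 1) * d by rewrite /d [RHS]mulrC divfK// gt_eqF.
  apply: (@le_lt_trans _ _ (`|k| * d)).
    by rewrite ler_wpM2l//; exact/ltW/fg.
  by rewrite ltr_pM2r// ltrDl.
apply: ltr_leD => //.
have -> : e / 2 = c * (M + d) by rewrite /c divfK// gt_eqF.
by apply: ler_pM => //; exact: ltW.
Qed.

Lemma strong_locally_convex : exists2 B : set_system strong_dual,
  (forall b, b \in B -> convex_set b) & basis B.
Proof.
pose O (f : strong_dual) (Be : set E * K) : set strong_dual :=
  [set g | exists2 d, d < Be.2 & forall x, Be.1 x -> `|f x - g x| <= d].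
exists [set O f Be | f in setT & Be in
    [set Be : set E * K | tvs_bounded Be.1 /\ 0 < Be.2]].
  move=> _ /[!inE] -[f _ [[B e] [/= bB e0] <-]] g h l /[!inE].
  move=> -[d1 /= d1e gd1] [d2 /= d2e hd2].
  have l0 : 0 <= l%:num by [].
  have l1 : 0 <= 1 - l%:num by rewrite subr_ge0.
  exists (l%:num * d1 + (1 - l%:num) * d2).
    have -> : e = l%:num * e + (1 - l%:num) * e by rewrite -mulrDl subrKC mul1r.
    have [l_eq0|ln0] := eqVneq (l%:num) 0.
      by rewrite l_eq0 !mul0r !add0r subr0 !mul1r.
    apply: ltr_leD; last by rewrite ler_wpM2l// ltW.
    by rewrite ltr_pM2l// lt_neqAle eq_sym ln0.
  move=> x Bx.
  change (`|f x - (l%:num * g x + (1 - l%:num) * h x)| <=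
    l%:num * d1 + (1 - l%:num) * d2).
  have -> : f x - (l%:num * g x + (1 - l%:num) * h x) =
      l%:num * (f x - g x) + (1 - l%:num) * (f x - h x).
    rewrite !mulrBr [LHS]addrC opprD addrACA -mulrDl subrKC mul1r.
    by rewrite -opprD addrC.
  apply: le_trans (ler_normD _ _) _; rewrite !normrM.
  rewrite (ger0_norm l0) (ger0_norm l1).
  by apply: lerD; apply: ler_wpM2l => //; [exact: gd1|exact: hd2].
split.
  move=> _ [f _ [[B e] [/= bB e0] <-]]; rewrite openE => g [d /= de gd].
  have ed0 : 0 < (e - d) / 2 by rewrite divr_gt0// subr_gt0.
  exists (B, (e - d) / 2) => // h gh.
  exists (d + (e - d) / 2).
    by rewrite -ltrBrDl ltr_pdivrMr// ltr_pMr ?subr_gt0// ltr1n.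
  move=> x Bx; rewrite -(subrKA (g x)); apply: le_trans (ler_normD _ _) _.
  by apply: lerD; [exact: gd|exact/ltW/gh].
move=> f U [[B e] [bB /= e0] BU].
exists (O f (B, e)).
  split; first by exists f => //; exists (B, e).
  by exists 0 => // x _; rewrite subrr normr0.
by move=> g [d /= de fg]; apply: BU => x Bx; apply: le_lt_trans de; exact: fg.
Qed.

HB.instance Definition _ :=
  PreTopologicalNmodule_isTopologicalNmodule.Build strong_dual strong_add_continuous.
HB.instance Definition _ :=
  TopologicalNmodule_isTopologicalLmodule.Build K strong_dual strong_scale_continuous.
(* In spite of its name, this factory only provides the uniform structure. *)
HB.instance Definition _ := PreTopologicalLmod_isTvs.Build K strong_dual
  strong_add_continuous strong_scale_continuous strong_locally_convex.
HB.instance Definition _ := Uniform_isTvs.Build K strong_dual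
  strong_locally_convex.

Lemma evaluation_continuous_linear (x : E) :
  (fun f : strong_dual => f x : K^o) \in @continuous_linear K strong_dual.
Proof.
apply/asboolP; split=> // f U /nbhs_ballP[e /= e0 eU].
exists ([set x], e); first by split=> //; exact: tvs_bounded1.
by move=> g /= fg; apply: eU; rewrite -ball_normE; exact: fg.
Qed.

Definition canonical_map (x : E) : dual strong_dual :=
  Dual (evaluation_continuous_linear x).

Definition semi_reflexive := bijective canonical_map.

End StrongDual.

Section Subspace.
Context {K : numFieldType} (E : tvsType K) (H : submodClosed E).

Definition subspace_tvs := {x : E | x \in H}.

HB.instance Definition _ := SubChoice.on subspace_tvs.
HB.instance Definition _ := [SubChoice_isSubLmodule of subspace_tvs by <:].
HB.instance Definition _ :=
  Topological.copy subspace_tvs (initial_topology (val : subspace_tvs -> E)).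

Lemma subspace_nbhsE (x : subspace_tvs) (U : set subspace_tvs) :
  nbhs x U <-> exists2 V : set E, nbhs (val x) V & val @^-1` V `<=` U.
Proof.
split.
  move=> [_ [[V oV <-] Vx VU]]; exists V => //.
  by apply: open_nbhs_nbhs; split.
by move=> [V Vx VU]; apply: filterS VU _; apply: initial_continuous.
Qed.

Lemma subspace_add_continuous :
  continuous (fun z : subspace_tvs * subspace_tvs => z.1 + z.2).
Proof.
move=> [x y] U /subspace_nbhsE[V Vxy VU].
have [[A B] [/= Ax By] ABV] := @add_continuous E (val x, val y) V Vxy.
exists (val @^-1` A, val @^-1` B).
  by split; apply/subspace_nbhsE; [exists A|exists B].
by move=> [a b] [/= Aa Bb]; apply: VU; exact: (ABV (val a, val b)).
Qed.

Lemma subspace_scale_continuous :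
  continuous (fun z : K^o * subspace_tvs => z.1 *: z.2).
Proof.
move=> [k x] U /subspace_nbhsE[V Vxy VU].
have [[A B] [/= Ax By] ABV] := @scale_continuous K E (k, val x) V Vxy.
exists (A, val @^-1` B).
  by split => //; apply/subspace_nbhsE; exists B.
by move=> [a b] [/= Aa Bb]; apply: VU; exact: (ABV (a, val b)).
Qed.

Lemma subspace_locally_convex : exists2 B : set_system subspace_tvs,
  (forall b, b \in B -> convex_set b) & basis B.
Proof.
have [B cB [oB bB]] := @locally_convex K E.
exists [set (val : subspace_tvs -> E) @^-1` b | b in B].
  move=> _ /[!inE] -[b Bb <-] x y l /[!inE] /= bx by_.
  by have := cB b (mem_set Bb) (val x) (val y) l (mem_set bx) (mem_set by_) => /set_mem.
split; first by move=> _ [b Bb <-]; exists b => //; exact: oB.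
move=> x U /subspace_nbhsE[V Vx VU].
have [b [Bb bx] bV] := bB (val x) V Vx.
exists (val @^-1` b); first by split=> //; exists b.
by apply: subset_trans VU => y /= /bV.
Qed.

HB.instance Definition _ :=
  PreTopologicalNmodule_isTopologicalNmodule.Build subspace_tvs subspace_add_continuous.
HB.instance Definition _ :=
  TopologicalNmodule_isTopologicalLmodule.Build K subspace_tvs subspace_scale_continuous.
HB.instance Definition _ := PreTopologicalLmod_isTvs.Build K subspace_tvs
  subspace_add_continuous subspace_scale_continuous subspace_locally_convex.
HB.instance Definition _ := Uniform_isTvs.Build K subspace_tvs
  subspace_locally_convex.

End Subspace.

(* Other locally convex topologies on a given vector space [V]: the space [V]
   with the topology [t] is [retopologized t], whose carrier is [V] itself. *)
Section Retopologized.
Context {K : numFieldType} (V : lmodType K).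

Definition with_opens of isOpenTopological V : Type := V.

HB.instance Definition _ (o : isOpenTopological V) :=
  GRing.Lmodule.copy (with_opens o) V.
HB.instance Definition _ (o : isOpenTopological V) :
  isOpenTopological (with_opens o) := o.

Record lc_topology := LcTopology {
  lc_opens : isOpenTopological V;
  lc_add_continuous : continuous
    (fun z : with_opens lc_opens * with_opens lc_opens => z.1 + z.2);
  lc_scale_continuous : continuous
    (fun z : K^o * with_opens lc_opens => z.1 *: z.2);
  lc_locally_convex : exists2 B : set_system (with_opens lc_opens),
    (forall b, b \in B -> convex_set b) & basis B }.

Definition retopologized (t : lc_topology) : Type := with_opens (lc_opens t).

Section Instances.
Variable t : lc_topology.

HB.instance Definition _ := GRing.Lmodule.on (retopologized t).
HB.instance Definition _ := Topological.on (retopologized t).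
HB.instance Definition _ :=
  PreTopologicalNmodule_isTopologicalNmodule.Build (retopologized t)
    (@lc_add_continuous t).
HB.instance Definition _ :=
  TopologicalNmodule_isTopologicalLmodule.Build K (retopologized t)
    (@lc_scale_continuous t).
HB.instance Definition _ := PreTopologicalLmod_isTvs.Build K (retopologized t)
  (@lc_add_continuous t) (@lc_scale_continuous t) (@lc_locally_convex t).
HB.instance Definition _ := Uniform_isTvs.Build K (retopologized t)
  (@lc_locally_convex t).

End Instances.

End Retopologized.

Definition compatible {K : numFieldType} (E : tvsType K) (t : lc_topology E) :=
  forall f : {linear E -> K^o},
    continuous (f : E -> K^o) <-> continuous (f : retopologized t -> K^o).

Definition absolutely_convex {K : numFieldType} (V : lmodType K) (D : set V) :=
  forall (a b : K) x y, `|a| + `|b| <= 1 -> D x -> D y -> D (a *: x + b *: y).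

Definition closed_absolutely_convex_hull {K : numFieldType} (E : tvsType K)
  (A : set E) : set E := closure (smallest (@absolutely_convex K E) A).

Inductive scalar_kind := RealScalars | ComplexScalars.

Definition scalars (R : realType) (k : scalar_kind) : numFieldType :=
  match k with RealScalars => R | ComplexScalars => complex.complex R end.

(* The norm of a complex number is itself a complex number in the library. *)
Definition modulus {R : realType} {k : scalar_kind} : scalars R k -> R :=
  match k with
  | RealScalars => fun z : R => `|z|
  | ComplexScalars => fun z : complex.complex R => complex.Re `|z|
  end.

(* Membership in ell_p of a sequence of extended reals, all of whose terms have
   to be finite; for p = +oo the space is c_0 rather than ell_oo. *)
Definition in_lp {R : realType} (p : \bar R) (u : nat -> \bar R) : Prop :=
  (forall n, u n \is a fin_num) /\
  match p with
  | r%:E => (\sum_(0 <= n <oo) `|u n| `^ r < +oo)%E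
  | +oo%E => u n @[n --> \oo] --> 0%E
  | -oo%E => False
  end.

Section Limited.
Context {R : realType} {k : scalar_kind}.
Implicit Types (E : tvsType (scalars R k)) (p q : \bar R).

Definition weakly_summable E p (x : nat -> E) :=
  forall f : dual E, in_lp p (fun n => (modulus (f (x n)))%:E).

(* The continuous linear functionals on E' with its weak* topology are the
   evaluations at the points of E. *)
Definition weakstar_summable E p (f : nat -> dual E) :=
  forall x : E, in_lp p (fun n => (modulus (f n x))%:E).

Definition equicontinuous_seq E (f : nat -> dual E) :=
  equicontinuous [set: nat] (fun n => f n : E -> (scalars R k)^o).

Definition p_barrelled E p :=
  forall f : nat -> dual E, weakstar_summable p f -> equicontinuous_seq f.

(* The supremum is possibly +oo, in which case [in_lp] fails. *)
Definition dual_norm E (A : set E) (f : dual E) : \bar R :=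
  ereal_sup [set (modulus (f x))%:E | x in A `|` [set 0]].

Definition limited E p q (A : set E) :=
  A !=set0 /\ forall f : nat -> dual E, weakstar_summable p f ->
    in_lp q (fun n => dual_norm A (f n)).

Definition Elimited E p q (A : set E) :=
  A !=set0 /\ forall f : nat -> dual E,
    equicontinuous_seq f -> weakstar_summable p f ->
    in_lp q (fun n => dual_norm A (f n)).

Definition Vstar_set E p q (A : set E) :=
  A !=set0 /\ forall f : nat -> strong_dual E, weakly_summable p f ->
    in_lp q (fun n => ereal_sup [set (modulus (f n a))%:E | a in A]).

Definition EVstar_set E p q (A : set E) :=
  A !=set0 /\ forall f : nat -> strong_dual E,
    equicontinuous_seq f -> weakly_summable p f ->
    in_lp q (fun n => ereal_sup [set (modulus (f n a))%:E | a in A]).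

Definition V_set E p q (B : set (dual E)) :=
  B !=set0 /\ forall x : nat -> E, weakly_summable p x ->
    in_lp q (fun n => ereal_sup [set (modulus (f (x n)))%:E | f in B]).

End Limited.

(* Main.v *)
Require Import Defs.
From HB Require Import structures.
From mathcomp Require Import all_boot all_order all_algebra ring zify.
From mathcomp Require Import complex.
From mathcomp Require Import all_classical all_reals all_analysis.

Set Implicit Arguments.
Unset Strict Implicit.
Unset Printing Implicit Defensive.

Import Order.TTheory GRing.Theory Num.Def Num.Theory.
Import numFieldNormedType.Exports.

Local Open Scope classical_set_scope.
Local Open Scope ring_scope.

(** Most of the assertions are a calculus of the numbers [dual_norm A f]. Both
    kinds of limited sets are instances of [limited_for F q A], where [F] is the
    class of sequences of functionals that are tested, and the permanence
    properties hold for every class: they follow from inequalities between dual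
    norms ([dual_norm_hull] for the closed absolutely convex hull, a finite sum
    of dual norms for unions and sums), from the fact that [in_lp] is stable
    under domination, sums and an increase of the exponent, and, where the space
    changes, from a pull-back of one class of sequences into another
    ([limited_for_image]), for linear images, subspaces and compatible
    topologies. Passing to the strong dual amounts to comparing two classes of
    sequences on the same space ([limited_for_le]). A countable
    subset that almost attains all the dual norms decides whether a set is
    limited, and so does one sequence that attains them up to a factor 2.

    Two assertions need functionals to exist. Let [r] be a continuous seminorm;
    by the Hahn-Banach theorem every point [a] has a functional dominated by
    [r] with modulus at least [r a] at [a] ([norming_dual]). If a set is
    unbounded, some [r] is unbounded on it, say with
    [2 ^+ n < r (a n)]; dividing the functional that norms [a n] by [2 ^+ n]
    gives an equicontinuous sequence, summable at every point, whose dual norms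
    on the set exceed 1 ([Elimited_bounded]). If a set contains [x != 0] and
    [q < p], multiply one functional that does not vanish at [x] by the terms of
    a sequence in l_p but not in l_q ([lp_strict], [Elimited_trivial]).

    The Hahn-Banach theorem is proved without partial functionals: Zorn's lemma
    gives a minimal sublinear functional below a given one, and a minimal
    sublinear functional is linear. The complex case is reduced to the real one
    by taking real parts ([complexify]). *)

(** * Sublinear functionals and the Hahn-Banach theorem *)

Section HahnBanach.
Context {R : realType} {V : lmodType R}.
Implicit Types (p q : V -> R) (x y z : V) (t : R).

Definition sublinear p :=
  (forall x y, p (x + y) <= p x + p y) /\
  (forall t x, 0 <= t -> p (t *: x) = t * p x).

Lemma sublinear0 p : sublinear p -> p 0 = 0.
Proof. by move=> [_ pZ]; rewrite -[0 in LHS](scale0r 0) pZ// mul0r. Qed.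

Lemma sublinear_geN p x : sublinear p -> - p (- x) <= p x.
Proof.
move=> sp; rewrite -subr_ge0 opprK -(sublinear0 sp) -{1}(subrr x).
exact: sp.1.
Qed.

Lemma sublinear_intro p : (forall x y, p (x + y) <= p x + p y) -> p 0 = 0 ->
  (forall t x, 0 < t -> p (t *: x) <= t * p x) -> sublinear p.
Proof.
move=> pD p0 pZ; split=> // t x; rewrite le_eqVlt => /predU1P[<-|t0].
  by rewrite scale0r mul0r.
apply/eqP; rewrite eq_le pZ//=.
have := pZ t^-1 (t *: x); rewrite invr_gt0 => /(_ t0).
by rewrite scalerA mulVf ?gt_eqF// scale1r ler_pdivlMl.
Qed.

Lemma has_inf_ge (S : set R) m : S !=set0 -> (forall s, S s -> m <= s) ->
  has_inf S.
Proof. by move=> S0 Sm; split=> //; exists m. Qed.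

(** Subadditivity passes to the infimum because, of two members of the chain,
    the smaller one bounds the value at [x + y] by the sum of the values of both.
    The bound [- p (- x)] keeps the infima finite. *)
Lemma inf_chain_sublinear p (A : set (V -> R)) : A !=set0 ->
  (forall q, A q -> sublinear q) ->
  (forall q r, A q -> A r -> (forall x, q x <= r x) \/ (forall x, r x <= q x)) ->
  (forall q, A q -> forall x, q x <= p x) ->
  let m := fun x => inf [set q x | q in A] in
  sublinear m /\ forall q, A q -> forall x, m x <= q x.
Proof.
move=> [q0 Aq0] Asub Atot Ap m.
have mhas x : has_inf [set q x | q in A].
  apply: (@has_inf_ge _ (- p (- x))); first by exists (q0 x), q0.
  move=> _ [q Aq <-]; apply: le_trans (sublinear_geN _ (Asub _ Aq)).
  by rewrite lerN2 Ap.
have mle q x : A q -> m x <= q x.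
  by move=> Aq; apply: ge_inf; [exact: (mhas x).2|exists q].
have lem x c : (forall q, A q -> c <= q x) -> c <= m x.
  move=> cA; apply: lb_le_inf; first exact: (mhas x).1.
  by move=> _ [q Aq <-]; exact: cA.
split; last by move=> q Aq x; exact: mle.
apply: (@sublinear_intro m).
- move=> x y; rewrite -lerBlDr; apply: (lem x) => q Aq.
  rewrite lerBlDr -lerBlDl; apply: (lem y) => r Ar; rewrite lerBlDl.
  have [qr|rq] := Atot _ _ Aq Ar.
    by apply: le_trans (mle q _ Aq) _; apply: le_trans ((Asub _ Aq).1 x y) _;
      rewrite lerD2l qr.
  by apply: le_trans (mle r _ Ar) _; apply: le_trans ((Asub _ Ar).1 x y) _;
    rewrite lerD2r rq.
- apply/eqP; rewrite eq_le; apply/andP; split.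
    by rewrite -(sublinear0 (Asub _ Aq0)) mle.
  by apply: (lem 0) => q Aq; rewrite (sublinear0 (Asub _ Aq)).
- move=> t x t0; rewrite -ler_pdivrMl//; apply: (lem x) => q Aq.
  by rewrite ler_pdivrMl// -((Asub _ Aq).2 t x (ltW t0)) mle.
Qed.

(** For sublinear [p], this is the largest sublinear functional below [p] whose
    value at [- y] is at most [- p y]. *)
Definition steepest p y : V -> R :=
  fun x => inf [set p (x + t *: y) - t * p y | t in [set t | 0 <= t]].

Section Steepest.
Variables (p : V -> R) (y : V).
Hypothesis sp : sublinear p.

Let has_inf_steepest x :
  has_inf [set p (x + t *: y) - t * p y | t in [set t | 0 <= t]].
Proof.
apply: (@has_inf_ge _ (- p (- x))).
  by exists (p (x + 0 *: y) - 0 * p y), 0 => /=.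
move=> _ [t /= t0 <-]; rewrite lerBrDr addrC lerBlDr -(sp.2 _ _ t0).
by rewrite -{1}[t *: y](addKr x) addrC (le_trans (sp.1 _ _))// addrC.
Qed.

Lemma steepest_le x t : 0 <= t -> steepest p y x <= p (x + t *: y) - t * p y.
Proof. by move=> t0; apply: ge_inf; [exact: (has_inf_steepest x).2|exists t]. Qed.

Let steepest_ge x c :
  (forall t, 0 <= t -> c <= p (x + t *: y) - t * p y) -> c <= steepest p y x.
Proof.
move=> cp; apply: lb_le_inf; first exact: (has_inf_steepest x).1.
by move=> _ [t t0 <-]; exact: cp.
Qed.

Lemma steepest_le_self x : steepest p y x <= p x.
Proof. by have := @steepest_le x 0 (lexx _); rewrite scale0r mul0r addr0 subr0. Qed.

Lemma steepest_sublinear : sublinear (steepest p y).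
Proof.
apply: sublinear_intro.
- move=> x z; rewrite -lerBlDr; apply: steepest_ge => t t0.
  rewrite lerBlDr -lerBlDl; apply: steepest_ge => s s0; rewrite lerBlDl.
  apply: le_trans (steepest_le _ (addr_ge0 t0 s0)) _.
  rewrite addrACA -opprD -mulrDl lerD2r scalerDl addrACA; exact: sp.1.
- apply/eqP; rewrite eq_le; apply/andP; split.
    by rewrite -(sublinear0 sp) steepest_le_self.
  by apply: steepest_ge => t t0; rewrite add0r sp.2// subrr.
- move=> t x t0; rewrite -ler_pdivrMl//; apply: steepest_ge => s s0.
  rewrite ler_pdivrMl// mulrBr mulrA -(sp.2 t _ (ltW t0)) scalerDr scalerA.
  by apply: steepest_le; rewrite mulr_ge0// ltW.
Qed.

End Steepest.

Lemma exists_minimal_sublinear p : sublinear p ->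
  exists q, [/\ sublinear q, forall x, q x <= p x &
    forall r, sublinear r -> (forall x, r x <= q x) -> r = q].
Proof.
move=> sp; pose T := {q : V -> R | sublinear q /\ forall x, q x <= p x}.
pose ge (s t : T) := `[< forall x, sval t x <= sval s x >].
have [||[s hs] [t ht] /asboolP /= st /asboolP /= ts|A Atot|[m [sm mp]] mmin] := @Zorn T ge.
- by move=> t; apply/asboolP.
- move=> r s t /asboolP rs /asboolP st; apply/asboolP => x.
  exact: le_trans (st x) (rs x).
- apply: eq_exist; apply/funext => x.
  by apply/eqP; rewrite eq_le ts st.
- have [->|/set0P[q0 Aq0]] := eqVneq A set0.
    by exists (exist (fun q => sublinear q /\ forall x, q x <= p x) p (conj sp (fun x => lexx _))).
  have [||||] := @inf_chain_sublinear p [set sval q | q in A].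
  + by exists (sval q0), q0.
  + by move=> _ [q Aq <-]; exact: (svalP q).1.
  + move=> _ _ [q Aq <-] [r Ar <-].
    by have [/asboolP|/asboolP] := Atot _ _ Aq Ar; [right|left].
  + by move=> _ [q Aq <-]; exact: (svalP q).2.
  move=> sm mA.
  have mp x : inf [set q x | q in [set sval q | q in A]] <= p x.
    apply: le_trans (mA (sval q0) _ x) _; first by exists q0.
    exact: (svalP q0).2.
  exists (exist (fun q => sublinear q /\ forall x, q x <= p x) _ (conj sm mp)).
  move=> q Aq; apply/asboolP => x /=.
  by apply: mA; exists q.
- exists m; split=> // r sr rm.
  have rp x : r x <= p x by exact: le_trans (rm x) (mp x).
  pose r' : T := exist (fun q => sublinear q /\ forall x, q x <= p x) r (conj sr rp).
  have := mmin r' (introT (asboolP _) rm).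
  by move=> /(congr1 (@proj1_sig _ _)) /= ->.
Qed.

(** A minimal [g] below [steepest p a] coincides with each [steepest g y], and
    taking [t = 1] in the infimum then reads [g x + g y <= g (x + y)]; so [g] is
    additive. Starting from [steepest p a] instead of [p] forces
    [g (- a) <= - p a], that is [p a <= g a]. *)
Theorem Hahn_Banach p a : sublinear p -> exists g : V -> R,
  [/\ linear (g : V -> R^o), forall x, g x <= p x & g a = p a].
Proof.
move=> sp; have [g [sg gp gmin]] :=
  exists_minimal_sublinear (steepest_sublinear a sp).
have gD x y : g (x + y) = g x + g y.
  apply/eqP; rewrite eq_le sg.1 /= -lerBrDr.
  rewrite -{1}(gmin _ (steepest_sublinear y sg) (steepest_le_self y sg)).
  by have := steepest_le y sg x ler01; rewrite scale1r mul1r.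
have gN x : g (- x) = - g x.
  by apply/eqP; rewrite -addr_eq0 -gD addNr (sublinear0 sg).
exists g; split.
- move=> t x y; rewrite gD; congr (_ + _).
  have [t0|/ltW t0] := leP 0 t; first exact: sg.2.
  rewrite -[t in LHS]opprK scaleNr gN sg.2 ?oppr_ge0//.
  by rewrite mulNr opprK.
- by move=> x; apply: le_trans (gp x) (steepest_le_self a sp x).
- apply/eqP; rewrite eq_le; apply/andP; split.
    exact: le_trans (gp a) (steepest_le_self a sp a).
  rewrite -lerN2 -gN; apply: le_trans (gp _) _.
  apply: le_trans (steepest_le a sp (- a) ler01) _.
  by rewrite scale1r addNr (sublinear0 sp) mul1r sub0r.
Qed.

End HahnBanach.

(** * Real and complex scalars *)

Section Scalars.
Context {R : realType} {k : scalar_kind}.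
Implicit Types (t s : R) (z w : scalars R k).

(** A complex modulus is real, but the norm of the scalar field takes its values
    in the field; this embedding carries [modulus] to that norm and lets the two
    cases be treated together. *)
Definition real_scalar : R -> scalars R k :=
  match k with
  | RealScalars => fun t : R => t
  | ComplexScalars => fun t : R => real_complex R t
  end.

Lemma real_scalar_is_zmod_morphism : zmod_morphism real_scalar.
Proof.
by rewrite /real_scalar /=; case: k => t s //=; exact: (rmorphB (real_complex R)).
Qed.

Lemma real_scalar_is_monoid_morphism : monoid_morphism real_scalar.
Proof.
by rewrite /real_scalar /=; case: k; split=> //= t s;
  exact: (rmorphM (real_complex R)).
Qed.

HB.instance Definition _ :=
  GRing.isZmodMorphism.Build R (scalars R k) real_scalar
    real_scalar_is_zmod_morphism.
HB.instance Definition _ :=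
  GRing.isMonoidMorphism.Build R (scalars R k) real_scalar
    real_scalar_is_monoid_morphism.

Lemma ler_real_scalar t s : (real_scalar t <= real_scalar s) = (t <= s).
Proof. by rewrite /real_scalar /=; case: k => //=; rewrite lecR. Qed.

Lemma real_scalar_inj : injective real_scalar.
Proof. exact: fmorph_inj. Qed.

Lemma real_scalar0 : real_scalar 0 = 0. Proof. exact: rmorph0. Qed.

Lemma real_scalar1 : real_scalar 1 = 1. Proof. exact: rmorph1. Qed.

Lemma real_scalarD t s : real_scalar (t + s) = real_scalar t + real_scalar s.
Proof. exact: rmorphD. Qed.

Lemma real_scalarM t s : real_scalar (t * s) = real_scalar t * real_scalar s.
Proof. exact: rmorphM. Qed.

Lemma real_scalarV t : real_scalar t^-1 = (real_scalar t)^-1.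
Proof. exact: fmorphV. Qed.

Lemma ltr_real_scalar t s : (real_scalar t < real_scalar s) = (t < s).
Proof. by rewrite !lt_neqAle ler_real_scalar (inj_eq real_scalar_inj). Qed.

Lemma norm_modulus z : `|z| = real_scalar (modulus z).
Proof. by move: z; rewrite /real_scalar /modulus /=; case: k => //= -[a b]. Qed.

Lemma modulus_ge0 z : 0 <= modulus z.
Proof. by rewrite -ler_real_scalar real_scalar0 -norm_modulus. Qed.

Lemma modulusM z w : modulus (z * w) = modulus z * modulus w.
Proof.
by apply: real_scalar_inj; rewrite real_scalarM -!norm_modulus normrM.
Qed.

Lemma ler_modulusD z w : modulus (z + w) <= modulus z + modulus w.
Proof. by rewrite -ler_real_scalar real_scalarD -!norm_modulus ler_normD. Qed.

Lemma modulusN z : modulus (- z) = modulus z.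
Proof. by apply: real_scalar_inj; rewrite -!norm_modulus normrN. Qed.

Lemma modulus0 : modulus (0 : scalars R k) = 0.
Proof. by apply: real_scalar_inj; rewrite -!norm_modulus normr0 real_scalar0. Qed.

Lemma modulusV z : modulus z^-1 = (modulus z)^-1.
Proof.
by apply: real_scalar_inj; rewrite real_scalarV -!norm_modulus normfV.
Qed.

Lemma modulus_eq0 z : (modulus z == 0) = (z == 0).
Proof. by rewrite -(inj_eq real_scalar_inj) real_scalar0 -norm_modulus normr_eq0. Qed.

Lemma modulus_real t : 0 <= t -> modulus (real_scalar t) = t.
Proof.
move=> t0; apply: real_scalar_inj; rewrite -norm_modulus ger0_norm//.
by rewrite -real_scalar0 ler_real_scalar.
Qed.

Lemma gt0_real_scalar (e : scalars R k) : 0 < e ->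
  exists2 t : R, 0 < t & e = real_scalar t.
Proof.
move=> e0; exists (modulus e); last by rewrite -norm_modulus gtr0_norm.
by rewrite lt_neqAle modulus_ge0 eq_sym modulus_eq0 gt_eqF.
Qed.

End Scalars.

Section Seminorms.
Context {R : realType} {k : scalar_kind} {E : lmodType (scalars R k)}.

Definition seminorm (p : E -> R) :=
  (forall x y, p (x + y) <= p x + p y) /\
  (forall (a : scalars R k) x, p (a *: x) = modulus a * p x).

Variable p : E -> R.
Hypothesis sp : seminorm p.

Lemma seminorm0 : p 0 = 0.
Proof. by rewrite -[0 in LHS](scale0r 0) sp.2 modulus0 mul0r. Qed.

Lemma seminormN x : p (- x) = p x.
Proof.
by rewrite -scaleN1r sp.2 modulusN -real_scalar1 modulus_real// mul1r.
Qed.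

Lemma seminorm_ge0 x : 0 <= p x.
Proof.
have := sp.1 x (- x); rewrite subrr seminorm0 seminormN -mulr2n.
by rewrite pmulrn_lge0.
Qed.

End Seminorms.

Section Realification.
Context {R : realType} {k : scalar_kind}.

(** The space with scalars restricted to the reals, on which the Hahn-Banach
    theorem applies whatever the scalar field is. *)
Definition realification (E : lmodType (scalars R k)) : Type := E.

Section Instances.
Variable E : lmodType (scalars R k).

HB.instance Definition _ := GRing.Zmodule.copy (realification E) E.

Let scale (t : R) (x : realification E) : realification E :=
  (real_scalar t : scalars R k) *: (x : E).

Let scaleA t s x : scale t (scale s x) = scale (t * s) x.
Proof. by rewrite /scale scalerA real_scalarM. Qed.

Let scale1 : left_id 1 scale.
Proof. by move=> x; rewrite /scale real_scalar1 scale1r. Qed.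

Let scaleDr : right_distributive scale +%R.
Proof. by move=> t x y; rewrite /scale scalerDr. Qed.

Let scaleDl x : {morph scale^~ x : t s / t + s}.
Proof. by move=> t s; rewrite /scale real_scalarD scalerDl. Qed.

HB.instance Definition _ := GRing.Zmodule_isLmodule.Build R (realification E)
  scaleA scale1 scaleDr scaleDl.

End Instances.

Lemma realification_scaleE (E : lmodType (scalars R k)) (t : R) (x : E) :
  t *: (x : realification E) = (real_scalar t : scalars R k) *: x.
Proof. by []. Qed.

End Realification.

(** Over the complex numbers [f x = g x - i g (i x)] is the complex-linear
    functional with real part [g]. Rotating [x] makes [f x] real and
    nonnegative, so the modulus of [f x] is a value of [g] on the unit disk times
    [x]: an upper bound of [g] by a seminorm is one of the modulus of [f]. *)
Lemma complexify {R : realType} {k : scalar_kind} (E : lmodType (scalars R k))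
    (g : E -> R) : linear (g : realification E -> R^o) ->
  exists f : E -> (scalars R k)^o, linear f /\ forall x,
    g x <= modulus (f x) /\
    exists2 a : scalars R k, modulus a <= 1 & modulus (f x) = g (a *: x).
Proof.
move=> lg; have g0 : g 0 = 0.
  by have := lg (-1) 0 0; rewrite scaler0 addr0 scaleN1r addNr.
case: k E g lg g0 => E g lg g0.
  exists g; split; first exact: lg.
  move=> x; split; first exact: ler_norm.
  have gN y : g (- y) = - g y.
    by have := lg (-1) y 0; rewrite !addr0 g0 addr0 !scaleN1r.
  have [x0|x0] := leP 0 (g x).
    by exists 1; rewrite /= ?normr1// scale1r ger0_norm.
  by exists (-1); rewrite /= ?normrN1// scaleN1r gN ltr0_norm.
have gD x y : g (x + y) = g x + g y by have := lg 1 x y; rewrite !scale1r.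
have gZ (t : R) x : g ((t%:C)%C *: x) = t * g x.
  by have := lg t x 0; rewrite !addr0 g0 addr0.
pose f x : R[i] := Complex (g x) (- g ('i%C *: x)).
have lf : linear (f : E -> (R[i])^o).
  move=> [a b] x y.
  have cE z : (Complex a b : scalars R ComplexScalars) *: z =
      (a%:C)%C *: z + (b%:C)%C *: ('i%C *: z).
    rewrite scalerA -scalerDl; congr (_ *: _).
    by apply/eqP; rewrite eq_complex /= !(mulr0, mul0r, mulr1, subr0, addr0, add0r) !eqxx.
  have iE : 'i%C *: (Complex a b *: x + y) =
      (Complex a b : scalars R ComplexScalars) *: ('i%C *: x) + 'i%C *: y.
    by rewrite scalerDr !scalerA mulrC.
  have ii : 'i%C *: ('i%C *: x) = ((-1)%:C)%C *: x.
    by rewrite scalerA -expr2 sqr_i rmorphN1.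
  have e : (Complex a b : (R[i])^o) *: (f x : (R[i])^o) + f y =
      Complex (a * g x + b * g ('i%C *: x) + g y)
        (- (a * g ('i%C *: x) - b * g x + g ('i%C *: y))).
    apply/eqP; rewrite eq_complex /= !mulrN opprK eqxx /=.
    by rewrite !opprD opprK addrAC.
  rewrite e /f iE !cE ii !gD !gZ.
  by rewrite mulN1r mulrN.
exists f; split=> // x.
split.
  rewrite /modulus normc_def /= (le_trans (ler_norm _))// -sqrtr_sqr.
  by rewrite ler_wsqrtr// lerDl sqr_ge0.
have gf y : g y = complex.Re (f y) by [].
have fZ a : f (a *: x) = a * f x.
  have f0 : f 0 = 0 by rewrite /f scaler0 g0 oppr0.
  by have := lf a x 0; rewrite !addr0 f0 addr0.
have [fx0|fx0] := eqVneq (f x) 0.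
  exists 0; first by rewrite modulus0.
  by rewrite fx0 modulus0 gf fZ mul0r.
(* the rotation that makes the value nonnegative *)
exists (`|f x| / f x).
  by rewrite -(@ler_real_scalar _ ComplexScalars) -norm_modulus normrM normr_id
    normfV divff ?normr_eq0.
by rewrite gf fZ divfK.
Qed.

(** * Gauges and norming functionals in locally convex spaces *)

Section Gauge.
Context {R : realType} {k : scalar_kind} {E : tvsType (scalars R k)}.
Local Notation rs := (@real_scalar R k).

(** Balanced and convex, with convexity expressed by real coefficients. *)
Definition disked (D : set E) :=
  (forall (a : scalars R k) x, modulus a <= 1 -> D x -> D (a *: x)) /\
  (forall (t : R) x y, 0 <= t <= 1 -> D x -> D y ->
     D (rs t *: x + rs (1 - t) *: y)).

(** The points all of whose multiples by scalars of modulus at most 1 stay in a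
    convex neighbourhood [C] form a convex balanced set. It is a neighbourhood
    of 0 since, by continuity of the multiplication, [e / 2] times some
    neighbourhood stays in [C] together with all these multiples. *)
Lemma disked_nbhs (U : set E) : nbhs 0 U ->
  exists D, [/\ disked D, nbhs 0 D & D `<=` U].
Proof.
move=> U0; have [B cB [oB bB]] := @locally_convex _ E.
have [C [BC C0] CU] := bB 0 U U0.
have {}C0 : nbhs 0 C by apply: open_nbhs_nbhs; split => //; exact: oB.
have {}cB (t : R) x y : 0 <= t <= 1 -> C x -> C y ->
    C (rs t *: x + rs (1 - t) *: y).
  move=> /andP[t0 t1] Cx Cy.
  have rt0 : 0 <= rs t by rewrite -real_scalar0 ler_real_scalar.
  have rt1 : rs t <= 1 by rewrite -real_scalar1 ler_real_scalar.
  have := cB C (mem_set BC) x y (Itv01 rt0 rt1) (mem_set Cx) (mem_set Cy).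
  by move=> /set_mem; rewrite rmorphB rmorph1.
exists [set x | forall a : scalars R k, modulus a <= 1 -> C (a *: x)]; split.
- split=> [a x a1 Cx b b1|t x y t01 Cx Cy a a1].
    rewrite scalerA; apply: Cx.
    by rewrite modulusM -[1]mulr1 ler_pM// modulus_ge0.
  rewrite scalerDr !scalerA ![a * _]mulrC -!scalerA.
  by apply: cB => //; [exact: Cx|exact: Cy].
- have := @scale_continuous _ E (0, 0) C; rewrite /= scaler0 => /(_ C0).
  move=> [[A V] [/= /nbhs_ballP[e /= e0 eA] V0] AVC].
  have e20 : e / 2 != 0 by rewrite gt_eqF// divr_gt0.
  apply: filterS (nbhs0Z e20 V0) => _ [x Vx <-] a a1 /=.
  rewrite scalerA; apply: (AVC (a * (e / 2), x)); split => //=; apply: eA.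
  rewrite -ball_normE /= sub0r normrN normrM norm_modulus.
  rewrite [`|e / 2|]gtr0_norm ?divr_gt0//.
  apply: (@le_lt_trans _ _ (1 * (e / 2))).
    by rewrite ler_pM2r ?divr_gt0// -real_scalar1 ler_real_scalar.
  by rewrite mul1r ltr_pdivrMr// ltr_pMr// ltr1n.
- move=> x Cx; apply: CU; rewrite -[x]scale1r; apply: Cx.
  by rewrite -real_scalar1 modulus_real.
Qed.

Definition gauge (D : set E) (x : E) : R :=
  inf [set t : R | 0 < t /\ D (rs t^-1 *: x)].

Section GaugeTheory.
Variable D : set E.
Hypotheses (dD : disked D) (D0 : nbhs 0 D).

Let has_inf_gauge x : has_inf [set t : R | 0 < t /\ D (rs t^-1 *: x)].
Proof.
split; last by exists 0 => t [/ltW].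
have [e e0 /(_ e) De] := tvs_bounded1 x D0.
have [t t0 et] := gt0_real_scalar e0.
exists t; split=> //.
have [|y Dy <-] := De _ x erefl; first by rewrite ger0_norm// ltW.
by rewrite /= et scalerA -real_scalarM mulVf ?gt_eqF// real_scalar1 scale1r.
Qed.

Lemma gauge_le x t : 0 < t -> D (rs t^-1 *: x) -> gauge D x <= t.
Proof. by move=> t0 Dt; apply: ge_inf; [exact: (has_inf_gauge x).2|split]. Qed.

Let gauge_ge x c : (forall t, 0 < t -> D (rs t^-1 *: x) -> c <= t) ->
  c <= gauge D x.
Proof.
move=> cD; apply: lb_le_inf; first exact: (has_inf_gauge x).1.
by move=> t [t0 Dt]; exact: cD.
Qed.

Lemma gauge_lt1 x : gauge D x < 1 -> D x.
Proof.
move=> /inf_lt-/(_ (has_inf_gauge x).1)[t [t0 Dt] t1].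
have -> : x = rs t *: (rs t^-1 *: x).
  by rewrite scalerA -real_scalarM divff ?gt_eqF// real_scalar1 scale1r.
by apply: dD.1 Dt; rewrite modulus_real ltW.
Qed.

Lemma gauge_seminorm : seminorm (gauge D).
Proof.
have g0 x : 0 <= gauge D x by apply: gauge_ge => t /ltW.
have gZ (a : scalars R k) x : a != 0 -> gauge D (a *: x) <= modulus a * gauge D x.
  move=> a0; have ma : 0 < modulus a by rewrite lt_neqAle eq_sym modulus_eq0 a0 modulus_ge0.
  rewrite -ler_pdivrMl//; apply: gauge_ge => t t0 Dt.
  rewrite ler_pdivrMl//; apply: gauge_le; first exact: mulr_gt0.
  rewrite invfM real_scalarM scalerA mulrAC -scalerA; apply: dD.1 Dt.
  by rewrite modulusM modulus_real ?invr_ge0 ?modulus_ge0// mulVf// gt_eqF.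
split=> [x y|a x].
  rewrite -lerBlDr; apply: gauge_ge => t t0 Dt.
  rewrite lerBlDr -lerBlDl; apply: gauge_ge => s s0 Ds; rewrite lerBlDl.
  have ts0 : 0 < t + s by exact: addr_gt0.
  apply: gauge_le => //.
  have -> : rs (t + s)^-1 *: (x + y) =
      rs (t / (t + s)) *: (rs t^-1 *: x) +
      rs (1 - t / (t + s)) *: (rs s^-1 *: y).
    rewrite !scalerA -!real_scalarM scalerDr; congr (rs _ *: _ + rs _ *: _).
      by rewrite mulrAC divff ?gt_eqF// mul1r.
    rewrite -{1}(divff (lt0r_neq0 ts0)) -mulrBl addrAC subrr add0r.
    by rewrite mulrAC divff ?gt_eqF// mul1r.
  apply: dD.2 => //; apply/andP; split; first by rewrite divr_ge0// ltW.
  by rewrite ler_pdivrMr// mul1r lerDl ltW.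
have [->|a0] := eqVneq a 0.
  rewrite scale0r modulus0 mul0r; apply/eqP; rewrite eq_le g0 andbT.
  apply/ler_addgt0Pr => e e0; rewrite add0r; apply: gauge_le => //.
  by rewrite scaler0; exact: nbhs_singleton.
apply/eqP; rewrite eq_le gZ//=.
have ma : 0 < modulus a by rewrite lt_neqAle eq_sym modulus_eq0 a0 modulus_ge0.
rewrite -ler_pdivlMl//.
have := @gZ a^-1 (a *: x); rewrite invr_eq0 => /(_ a0).
by rewrite scalerA mulVf// scale1r modulusV.
Qed.

Lemma gauge_nbhs : nbhs 0 [set x | gauge D x <= 1].
Proof.
apply: filterS D0 => x Dx /=; apply: gauge_le => //.
by rewrite invr1 real_scalar1 scale1r.
Qed.

End GaugeTheory.

(** Local convexity in terms of seminorms: every neighbourhood of 0 contains the open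
    unit ball of a seminorm that is continuous, as its closed unit ball is a
    neighbourhood of 0. *)
Lemma tvs_seminorm (U : set E) : nbhs 0 U -> exists p : E -> R,
  [/\ seminorm p, nbhs 0 [set x | p x <= 1] & [set x | p x < 1] `<=` U].
Proof.
move=> /disked_nbhs[D [dD D0 DU]]; exists (gauge D); split.
- exact: gauge_seminorm.
- exact: gauge_nbhs.
- by move=> x /gauge_lt1 => /(_ dD D0)/DU.
Qed.

Lemma seminorm_nbhs (p : E -> R) (x : E) (e : R) : seminorm p ->
  nbhs 0 [set x | p x <= 1] -> 0 < e -> nbhs x [set y | p (x - y) < e].
Proof.
move=> sp p1 e0.
have e20 : rs (e / 2) != 0.
  by rewrite -real_scalar0 (inj_eq real_scalar_inj) gt_eqF// divr_gt0.
apply: filterS (nbhsT x (nbhs0Z e20 p1)) => _ [_ [y /= py <-] <-] /=.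
rewrite opprD addNKr (seminormN sp) sp.2 modulus_real ?divr_ge0 ?ltW//.
apply: (@le_lt_trans _ _ (e / 2 * 1)); first by rewrite ler_pM2l ?divr_gt0.
by rewrite mulr1 ltr_pdivrMr// ltr_pMr// ltr1n.
Qed.

Lemma seminorm_equicontinuous {I : Type} (f : I -> E -> (scalars R k)^o)
    (p : E -> R) : seminorm p -> nbhs 0 [set x | p x <= 1] ->
  (forall i, linear (f i)) -> (forall i x, modulus (f i x) <= p x) ->
  equicontinuous [set: I] f.
Proof.
move=> sp p1 lf fp x W; rewrite -entourage_ballE => -[e /= e0 eW].
have [t t0 et] := gt0_real_scalar e0.
apply: filterS (seminorm_nbhs x sp p1 t0) => y /= pxy i _; apply: eW => /=.
have lfB : f i x - f i y = f i (x - y).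
  by have := lf i (-1) y x; rewrite !scaleN1r [- y + x]addrC => ->; rewrite addrC.
rewrite -ball_normE /= lfB norm_modulus et ltr_real_scalar.
exact: le_lt_trans (fp _ _) pxy.
Qed.

(** The Hahn-Banach theorem on the realification, made scalar-linear; the
    domination by [p] gives continuity. *)
Theorem norming_dual (p : E -> R) (a : E) : seminorm p ->
  nbhs 0 [set x | p x <= 1] ->
  exists f : dual E, (forall x, modulus (f x) <= p x) /\ p a <= modulus (f a).
Proof.
move=> sp p1.
have [|g [lg gp ga]] := @Hahn_Banach R (realification E) p a.
  by split; [exact: sp.1|move=> t x t0; rewrite realification_scaleE sp.2 modulus_real].
have [f [lf fg]] := complexify lg.
have fp x : modulus (f x) <= p x.
  have [_ [b b1 ->]] := fg x; apply: le_trans (gp _) _.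
  by rewrite sp.2 ler_piMl// (seminorm_ge0 sp).
have cf : continuous (f : E -> (scalars R k)^o).
  apply: (@equicontinuous_continuous _ _ unit setT (fun _ => f) tt) => //.
  exact: (seminorm_equicontinuous sp p1).
have F : (f : E -> (scalars R k)^o) \in @continuous_linear _ E.
  by apply/asboolP; split.
exists (Dual F); split=> //=.
by rewrite -ga; exact: (fg a).1.
Qed.

End Gauge.

(** * Sequence spaces *)

Section SequenceSpaces.
Context {R : realType}.
Implicit Types (p q : \bar R) (r s : R) (u v : nat -> R) (U V : nat -> \bar R).

Lemma in_lp_inftyP u : (forall n, 0 <= u n) ->
  in_lp +oo%E (fun n => (u n)%:E) <-> forall e, 0 < e -> \forall n \near \oo, u n < e.
Proof.
move=> u0; split=> [[_ /fine_cvgP[_ /cvgr0_norm_lt u_lt]] e e0|u_lt].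
  by near=> n; rewrite -[u n]ger0_norm//; near: n; exact: u_lt.
split=> //; apply: cvg_EFin; first exact: nearW.
apply/cvgr0Pnorm_lt => e e0; near=> n; rewrite /= ger0_norm//.
by near: n; exact: u_lt.
Unshelve. all: by end_near. Qed.

(** Bounded partial sums are easier to manipulate than a finite sum of a series of
    extended reals. *)
Lemma in_lp_finP r u : (forall n, 0 <= u n) ->
  in_lp r%:E (fun n => (u n)%:E) <->
  exists M, forall N, \sum_(0 <= n < N) u n `^ r <= M.
Proof.
move=> u0.
have sumE N : (\sum_(0 <= n < N) `|(u n)%:E| `^ r =
    (\sum_(0 <= n < N) u n `^ r)%:E)%E.
  rewrite -sumEFin; apply: eq_bigr => n _.
  by rewrite abse_EFin poweR_EFin ger0_norm.
have ge0 n : (0 <= `|(u n)%:E| `^ r)%E by exact: poweR_ge0.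
split=> [[_ fin]|[M uM]].
  have fs : (\sum_(0 <= n <oo) `|(u n)%:E| `^ r)%E \is a fin_num.
    by rewrite ge0_fin_numE//; exact: nneseries_ge0.
  exists (fine (\sum_(0 <= n <oo) `|(u n)%:E| `^ r)%E) => N.
  by rewrite -lee_fin -sumE fineK//; exact: nneseries_lim_ge.
split=> //; apply: (@le_lt_trans _ _ M%:E); last exact: ltry.
apply: lime_le; first exact: is_cvg_nneseries.
by apply: nearW => N; rewrite sumE lee_fin.
Qed.

Lemma in_lp_le p U V : (1 <= p)%E -> (forall n, 0 <= U n <= V n)%E ->
  in_lp p V -> in_lp p U.
Proof.
move=> p1 UV [finV lpV].
have finU n : U n \is a fin_num.
  have /andP[U0 UVn] := UV n; rewrite ge0_fin_numE//.
  by apply: le_lt_trans UVn _; rewrite ltey_eq finV.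
split=> //; case: p p1 lpV => [r|_|//]; last first.
  by move=> /=; apply: (@squeeze_cvge _ _ _ _ (cst 0%E) U V (nearW _ UV)); exact: cvg_cst.
rewrite lee_fin => r1; apply: le_lt_trans; apply: lee_nneseries.
  by move=> *; exact: poweR_ge0.
move=> n _; have /andP[U0 UVn] := UV n.
have V0 := le_trans U0 UVn.
rewrite (gee0_abs U0) (gee0_abs V0).
by apply: gt0_ler_poweR => //; rewrite ?(le_trans ler01 r1)// in_itv/= ?leey ?andbT.
Qed.

Lemma in_lp_fine p U : in_lp p U -> exists u, U = fun n => (u n)%:E.
Proof.
by move=> [finU _]; exists (fine \o U); apply/funext => n; rewrite /= fineK.
Qed.

Lemma powR_le r a b : 1 <= r -> 0 <= a -> a <= b -> a `^ r <= b `^ r.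
Proof.
move=> r1 a0 ab; apply: ge0_ler_powR => //; rewrite ?(le_trans ler01 r1)//.
by rewrite nnegrE (le_trans a0).
Qed.

Lemma in_lpZ p u c : (1 <= p)%E -> (forall n, 0 <= u n) -> 0 < c ->
  in_lp p (fun n => (u n)%:E) -> in_lp p (fun n => (c * u n)%:E).
Proof.
move=> p1 u0 c0.
have cu0 n : 0 <= c * u n by rewrite mulr_ge0// ltW.
case: p p1 => [r r1|_|//].
  move=> /in_lp_finP[//|M uM]; apply/in_lp_finP => //.
  exists (c `^ r * M) => N.
  under eq_bigr => n _ do rewrite powRM// ?ltW//.
  by rewrite -mulr_sumr ler_wpM2l// powR_ge0.
move=> /in_lp_inftyP-/(_ u0) ul; apply/in_lp_inftyP => // e e0.
have := ul (e / c) (divr_gt0 e0 c0); apply: filterS => n.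
by rewrite ltr_pdivlMr// mulrC.
Qed.

Lemma in_lp_max p u v : (1 <= p)%E ->
  (forall n, 0 <= u n) -> (forall n, 0 <= v n) ->
  in_lp p (fun n => (u n)%:E) -> in_lp p (fun n => (v n)%:E) ->
  in_lp p (fun n => (Num.max (u n) (v n))%:E).
Proof.
move=> p1 u0 v0; have uv0 n : 0 <= Num.max (u n) (v n) by rewrite le_max u0.
case: p p1 => [r r1|_|//].
  move=> /in_lp_finP[//|M uM] /in_lp_finP[//|N vN]; apply/in_lp_finP => //.
  exists (M + N) => K; apply: le_trans (lerD (uM K) (vN K)).
  rewrite -big_split /=; apply: ler_sum => n _.
  by have [_|_] := leP (u n) (v n); [rewrite lerDr powR_ge0|rewrite lerDl powR_ge0].
move=> /in_lp_inftyP-/(_ u0) ul /in_lp_inftyP-/(_ v0) vl.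
apply/in_lp_inftyP => // e e0; near=> n.
by rewrite gt_max; apply/andP; split; near: n; [exact: ul|exact: vl].
Unshelve. all: by end_near. Qed.

Lemma in_lpD p u v : (1 <= p)%E ->
  (forall n, 0 <= u n) -> (forall n, 0 <= v n) ->
  in_lp p (fun n => (u n)%:E) -> in_lp p (fun n => (v n)%:E) ->
  in_lp p (fun n => (u n + v n)%:E).
Proof.
move=> p1 u0 v0 lu lv.
have m0 n : 0 <= Num.max (u n) (v n) by rewrite le_max u0.
apply: in_lp_le (in_lpZ p1 m0 (ltr0n _ 2) (in_lp_max p1 u0 v0 lu lv)) => // n.
rewrite !lee_fin addr_ge0//= mulr_natl mulr2n.
by rewrite lerD// le_max lexx ?orbT.
Qed.

Lemma sum_ge_term u N n : (forall m, 0 <= u m) -> (n < N)%N ->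
  u n <= \sum_(0 <= m < N) u m.
Proof.
move=> u0 nN; rewrite big_mkord (bigD1 (Ordinal nN))//= lerDl.
exact: sumr_ge0.
Qed.

Lemma in_lp_bounded_cvg u : (forall n, 0 <= u n) ->
  (exists M, forall N, \sum_(0 <= n < N) u n <= M) -> cvgn (series u).
Proof.
move=> u0 [M uM]; apply: nondecreasing_is_cvgn.
  by apply/nondecreasing_seqP => n; rewrite /series /= big_nat_recr//= lerDl.
by exists M => _ [n _ <-]; exact: uM.
Qed.

Lemma powRK r a : 0 < r -> 0 <= a -> (a `^ r) `^ r^-1 = a.
Proof. by move=> r0 a0; rewrite -powRrM divff ?gt_eqF// powRr1. Qed.

Lemma in_lp_c0 p u : (1 <= p)%E -> (forall n, 0 <= u n) ->
  in_lp p (fun n => (u n)%:E) -> in_lp +oo%E (fun n => (u n)%:E).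
Proof.
move=> p1 u0; case: p p1 => [r r1|//|//] /in_lp_finP-/(_ u0) ur.
have ur0 n : 0 <= u n `^ r by exact: powR_ge0.
have /cvg_series_cvg_0/cvgr0_norm_lt cu := in_lp_bounded_cvg ur0 ur.
apply/in_lp_inftyP => // e e0.
have := cu _ (powR_gt0 r e0); apply: filterS => n.
rewrite ger0_norm// !ltNge; apply: contra; exact/powR_le/ltW.
Qed.

(** Each term is at most [b := M `^ r^-1], where [M] bounds the partial sums for
    the exponent [r], and a term to the power [s] is then at most its power [r]
    times [b `^ (s - r)]. *)
Lemma in_lp_mono p q u : (1 <= p)%E -> (p <= q)%E -> (forall n, 0 <= u n) ->
  in_lp p (fun n => (u n)%:E) -> in_lp q (fun n => (u n)%:E).
Proof.
move=> p1 pq u0 lpu; case: q pq => [s|_|]; first last.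
- by rewrite leNgt ltNye_eq => /negP; case: p p1 lpu.
- exact: in_lp_c0 p1 _ lpu.
case: p p1 lpu => [r r1|//|//] /in_lp_finP-/(_ u0)[M uM].
rewrite lee_fin => rs; apply/in_lp_finP => //.
have r0 : 0 < r by exact: lt_le_trans ltr01 r1.
exists (M * (M `^ r^-1) `^ (s - r)) => N.
apply: (@le_trans _ _ (\sum_(0 <= n < N) (u n `^ r) * (M `^ r^-1) `^ (s - r))).
  apply: ler_sum => n _.
  have -> : u n `^ s = u n `^ r * u n `^ (s - r).
    by rewrite -powRD subrKC// gt_eqF// (lt_le_trans r0 rs).
  rewrite ler_wpM2l ?powR_ge0//; apply: ge0_ler_powR; rewrite ?subr_ge0//.
  - by rewrite nnegrE.
  - by rewrite nnegrE powR_ge0.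
  - rewrite -{1}(powRK r0 (u0 n)); apply: ge0_ler_powR.
    + by rewrite invr_ge0 ltW.
    + by rewrite nnegrE powR_ge0.
    + by rewrite nnegrE; have := uM 0%N; rewrite big_geq.
    apply: le_trans (uM n.+1).
    by apply: (@sum_ge_term (fun n => u n `^ r)) => // m; exact: powR_ge0.
by rewrite -mulr_suml ler_wpM2r// powR_ge0.
Qed.

Lemma in_lp_geometric p (c : R) : (1 <= p)%E -> 0 <= c ->
  in_lp p (fun n => (c / 2 ^+ n)%:E).
Proof.
move=> p1 c0.
have u0 n : 0 <= c / 2 ^+ n by rewrite divr_ge0.
apply: (in_lp_mono _ p1) => //; apply/in_lp_finP => //.
exists (c * 2) => N.
suff -> : \sum_(0 <= n < N) (c / 2 ^+ n) `^ 1 = c * 2 - c * 2 / 2 ^+ N.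
  by rewrite gerBl divr_ge0// mulr_ge0.
elim: N => [|N IH]; first by rewrite big_geq// expr0 divr1 subrr.
rewrite big_nat_recr//= IH powRr1// exprS invfM mulrA mulfK//.
by field.
Qed.

(** Grouping the terms of indices [2 j] and [2 j + 1], with sum at most
    [2 (2 j)^(-s)], gives [S (2 N + 1) <= 1 + rho * S N] with
    [rho = 2^(1 - s) < 1]. As [S N <= S (2 N + 1)], the number [(1 - rho)^-1]
    bounds all partial sums. *)
Lemma riemann_bounded s : 1 < s ->
  exists M, forall N, \sum_(0 <= n < N) (n.+1%:R : R) `^ (- s) <= M.
Proof.
move=> s1; pose S N := \sum_(0 <= n < N) (n.+1%:R : R) `^ (- s).
have SS N : S N.+1 = S N + (N.+1%:R : R) `^ (- s) by rewrite /S big_nat_recr.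
pose rho : R := 2 `^ (1 - s).
have S_double N : S N.*2.+1 <= 1 + rho * S N.
  elim: N => [|N IH]; first by rewrite /S big_nat1 big_geq// powR1 mulr0 addr0.
  rewrite doubleS (SS N) (SS N.*2.+2) (SS N.*2.+1) mulrDr addrA -[leLHS]addrA.
  apply: lerD => //.
  have rhoE : rho * (N.+1%:R : R) `^ (- s) = 2 * (N.+1.*2%:R : R) `^ (- s).
    rewrite -mul2n natrM powRM// mulrA; congr (_ * _).
    by rewrite /rho powRD ?powRr1// pnatr_eq0 implybT.
  rewrite rhoE mulrDl mul1r -doubleS lerD//.
  rewrite !powRN lef_pV2 ?posrE ?powR_gt0//.
  apply: ge0_ler_powR; rewrite ?nnegrE ?ler_nat//.
  exact: ltW (lt_trans ltr01 s1).
have rho1 : rho < 1.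
  rewrite /rho -[ltRHS](powRr0 2) /powR gt_eqF// ltr_expR.
  by rewrite ltr_pM2r ?subr_lt0// ln_gt0 ?ltr1n.
exists (1 - rho)^-1 => N; rewrite -/(S N).
rewrite -[leRHS]mul1r ler_pdivlMr ?subr_gt0// mulrBr mulr1 lerBlDr mulrC.
apply: le_trans (S_double N).
rewrite {2}/S (@big_cat_nat _ _ _ N 0 N.*2.+1)//=; last by lia.
by rewrite lerDl sumr_ge0// => n _; exact: powR_ge0.
Qed.

(** The witness is the sequence of the [(n + 1)^(- 1 / q)]: its q-th powers form
    the harmonic series, and its p-th powers a Riemann series of exponent
    [p / q > 1]. Boundedness by 1 keeps the multiples of a functional by its terms
    equicontinuous. *)
Lemma lp_strict p q : (1 <= q)%E -> (q < p)%E -> exists2 u : nat -> R,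
  (forall n, 0 <= u n <= 1) & in_lp p (fun n => (u n)%:E) /\ ~ in_lp q (fun n => (u n)%:E).
Proof.
move=> q1 qp; case: q q1 qp => [s s1 sp|_|//]; last by rewrite ltNge leey.
have s0 : 0 < s by exact: lt_le_trans ltr01 s1.
pose u n : R := (n.+1%:R^-1) `^ s^-1.
have u0 n : 0 <= u n by exact: powR_ge0.
have us n : u n `^ s = n.+1%:R^-1 by rewrite -powRrM mulVf ?gt_eqF// powRr1.
exists u.
  move=> n; rewrite u0/= -[leRHS](powRK s0 ler01) powR1; apply: ge0_ler_powR.
  - by rewrite invr_ge0 ltW.
  - by rewrite nnegrE invr_ge0.
  - by rewrite nnegrE.
  - by rewrite invf_le1// ler1n.
split; last first.
  move=> /in_lp_finP-/(_ u0)[M uM]; apply: (@dvg_harmonic R).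
  apply: in_lp_bounded_cvg; first by move=> n; rewrite invr_ge0.
  by exists M => N; apply: le_trans (uM N); apply: ler_sum => n _; rewrite us.
case: p sp => [r sr|_|//].
  apply/in_lp_finP => //.
  have [|M riM] := @riemann_bounded (s^-1 * r).
    by rewrite mulrC ltr_pdivlMr// mul1r.
  exists M => N; apply: le_trans (riM N); apply: ler_sum => n _.
  by rewrite /u -powR_inv1// -!powRrM !mulN1r.
apply/in_lp_inftyP => // e e0.
have /cvgr0_norm_lt/(_ _ (powR_gt0 s e0)) := @cvg_harmonic R.
apply: filterS => n; rewrite -[harmonic n]us ger0_norm ?powR_ge0// !ltNge.
apply: contra.
exact/powR_le/ltW.
Qed.

End SequenceSpaces.

Section SequenceSpacesEreal.
Context {R : realType}.
Implicit Types (p q : \bar R) (U V : nat -> \bar R).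

Lemma in_lp_cst0 p : (1 <= p)%E -> in_lp p (fun _ : nat => 0%E : \bar R).
Proof.
move=> p1; apply: in_lp_le (in_lp_geometric p1 ler01) => // n.
by rewrite lexx lee_fin divr_ge0.
Qed.

Lemma in_lpDe p U V : (1 <= p)%E ->
  (forall n, 0 <= U n)%E -> (forall n, 0 <= V n)%E ->
  in_lp p U -> in_lp p V -> in_lp p (fun n => U n + V n)%E.
Proof.
move=> p1 + + lU lV; have [u eU] := in_lp_fine lU; have [v eV] := in_lp_fine lV.
move: lU lV; rewrite {}eU {}eV => lu lv u0 v0.
by apply: in_lpD => // n; rewrite -lee_fin.
Qed.

Lemma in_lp_sum p (I : Type) (s : seq I) (U : I -> nat -> \bar R) :
  (1 <= p)%E -> (forall i n, 0 <= U i n)%E -> (forall i, in_lp p (U i)) ->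
  in_lp p (fun n => \sum_(i <- s) U i n)%E.
Proof.
move=> p1 U0 lU; elim: s => [|i s IH].
  by under eq_fun do rewrite big_nil; exact: in_lp_cst0.
under eq_fun do rewrite big_cons.
by apply: in_lpDe => // n; exact: sume_ge0.
Qed.

Lemma in_lp_monoe p q U : (1 <= p)%E -> (p <= q)%E -> (forall n, 0 <= U n)%E ->
  in_lp p U -> in_lp q U.
Proof.
move=> p1 pq + lU; have [u eU] := in_lp_fine lU.
move: lU; rewrite {}eU => lu u0.
by apply: in_lp_mono lu => // n; rewrite -lee_fin.
Qed.

End SequenceSpacesEreal.

(** * Dual norms and sets limited for a class of sequences *)

Section DualNorm.
Context {R : realType} {k : scalar_kind} {E : tvsType (scalars R k)}.
Implicit Types (A B : set E) (f : dual E) (M : \bar R).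

Lemma dual0 f : f 0 = 0. Proof. exact: linear0. Qed.

Lemma dual_norm_ge0 A f : (0 <= dual_norm A f)%E.
Proof.
apply: le_ereal_sup_tmp; exists (modulus (f 0))%:E.
  by exists 0 => //; right.
by rewrite lee_fin modulus_ge0.
Qed.

Lemma dual_norm_ub A f x : A x -> ((modulus (f x))%:E <= dual_norm A f)%E.
Proof.
move=> Ax; apply: le_ereal_sup_tmp; exists (modulus (f x))%:E => //.
by exists x => //; left.
Qed.

Lemma dual_norm_le A f M : (0 <= M)%E ->
  (forall x, A x -> (modulus (f x))%:E <= M)%E -> (dual_norm A f <= M)%E.
Proof.
move=> M0 AM; apply/ereal_supP => _ [x [Ax|->] <-]; first exact: AM.
by rewrite dual0 modulus0.
Qed.

(** The point 0 adds nothing to the supremum over a nonempty set, as the values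
    are nonnegative. This turns the suprema over a set or over a family
    of functionals into dual norms. *)
Lemma dual_norm_sup A f : A !=set0 ->
  ereal_sup [set (modulus (f a))%:E | a in A] = dual_norm A f.
Proof.
move=> [a Aa]; apply/eqP; rewrite eq_le; apply/andP; split.
  by apply/ereal_supP => _ [x Ax <-]; exact: dual_norm_ub.
have sup_ub x : A x ->
    ((modulus (f x))%:E <= ereal_sup [set (modulus (f a))%:E | a in A])%E.
  by move=> Ax; apply: le_ereal_sup_tmp; exists (modulus (f x))%:E => //; exists x.
apply: dual_norm_le => //; apply: le_trans (sup_ub a Aa).
by rewrite lee_fin modulus_ge0.
Qed.

(** The set where the modulus of [f] is at most a real [M] is closed and
    absolutely convex, so it contains the hull of [A] as soon as it contains
    [A]. *)
Lemma dual_norm_hull A f :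
  (dual_norm (closed_absolutely_convex_hull A) f <= dual_norm A f)%E.
Proof.
case eM : (dual_norm A f) (dual_norm_ge0 A f) => [M| |]; last by [].
  rewrite lee_fin => M0; apply: dual_norm_le => // x Hx; rewrite lee_fin.
  rewrite leNgt; apply/negP => Mx.
  have xM0 : 0 < modulus (f x) - M by rewrite subr_gt0.
  have e0 : 0 < real_scalar (modulus (f x) - M) :> scalars R k.
    by rewrite -real_scalar0 ltr_real_scalar.
  have [y [Hy]] := Hx _ (@dual_continuous _ _ f x _ (nbhsx_ballx _ _ e0)).
  rewrite /= -ball_normE /= norm_modulus ltr_real_scalar.
  have yM : modulus (f y) <= M.
    apply: (Hy [set z | modulus (f z) <= M]); split.
    - move=> a b u v ab /= fu fv; rewrite linearD !linearZ /=.
      apply: le_trans (ler_modulusD _ _) _; rewrite !modulusM.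
      apply: (@le_trans _ _ ((modulus a + modulus b) * M)).
        by rewrite mulrDl lerD// ler_wpM2l// modulus_ge0.
      rewrite ler_piMl// -(@ler_real_scalar _ k) real_scalarD real_scalar1.
      by rewrite -!norm_modulus.
    - by move=> z Az /=; rewrite -lee_fin -eM; exact: dual_norm_ub.
  apply/negP; rewrite -leNgt lerBlDr.
  apply: le_trans (lerD (lexx (modulus (f x - f y))) yM).
  by rewrite -{1}(subrK (f y) (f x)) ler_modulusD.
by move=> _; rewrite leey.
Qed.

End DualNorm.

Section LimitedFor.
Context {R : realType} {k : scalar_kind}.
Implicit Types (p q : \bar R).

(** A common generalization of limited and E-limited sets, which makes it
    possible to prove each permanence property once. *)
Definition limited_for (E : tvsType (scalars R k))
    (F : set (nat -> dual E)) q (A : set E) :=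
  A !=set0 /\ forall f, F f -> in_lp q (fun n => dual_norm A (f n)).

Section Class.
Context {E : tvsType (scalars R k)} (F : set (nat -> dual E)).
Variable q : \bar R.
Hypothesis q1 : (1 <= q)%E.
Implicit Types (A B : set E).

Lemma limited_for_sub A B : B `<=` A -> B !=set0 ->
  limited_for F q A -> limited_for F q B.
Proof.
move=> BA B0 [A0 lA]; split=> // f Ff; apply: in_lp_le (lA f Ff) => // n.
rewrite dual_norm_ge0 dual_norm_le ?dual_norm_ge0// => x /BA.
exact: dual_norm_ub.
Qed.

Lemma limited_for_bigcup n (A : 'I_n.+1 -> set E) :
  (forall i, limited_for F q (A i)) -> limited_for F q (\bigcup_i A i).
Proof.
move=> lA; have [[x Ax] _] := lA ord0; split; first by exists x, ord0.
move=> f Ff; pose U i m := dual_norm (A i) (f m).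
have U0 i m : (0 <= U i m)%E by exact: dual_norm_ge0.
have := in_lp_sum (index_enum _) q1 U0 (fun i => (lA i).2 f Ff).
apply: in_lp_le => // m; rewrite dual_norm_ge0 dual_norm_le//.
  by apply: sume_ge0.
move=> y [i _ Aiy]; apply: le_trans (dual_norm_ub _ Aiy) _.
by rewrite (bigD1 i)//= leeDl// sume_ge0.
Qed.

Lemma limited_for_sum n (A : 'I_n.+1 -> set E) :
  (forall i, limited_for F q (A i)) ->
  limited_for F q [set \sum_i a i | a in [set a | forall i, A i (a i)]].
Proof.
move=> lA; split.
  have /choice[a Aa] i : exists x, A i x by exact: (lA i).1.
  by exists (\sum_i a i), a.
move=> f Ff; pose U i m := dual_norm (A i) (f m).
have U0 i m : (0 <= U i m)%E by exact: dual_norm_ge0.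
have := in_lp_sum (index_enum _) q1 U0 (fun i => (lA i).2 f Ff).
apply: in_lp_le => // m; rewrite dual_norm_ge0 dual_norm_le//.
  by apply: sume_ge0.
move=> _ [a /= Aa <-]; rewrite linear_sum /=.
apply: (@le_trans _ _ (\sum_i (modulus (f m (a i)))%:E)%E).
  rewrite sumEFin lee_fin.
  elim/big_ind2 : _ => [|x y z t xy zt|//]; first by rewrite modulus0.
  by apply: le_trans (ler_modulusD _ _) _; exact: lerD.
by apply: lee_sum => i _; exact: dual_norm_ub.
Qed.

Lemma limited_for_hull A : limited_for F q A ->
  limited_for F q (closed_absolutely_convex_hull A).
Proof.
move=> [[a Aa] lA]; split.
  by exists a; apply: subset_closure => B [_]; apply.
move=> f Ff; apply: in_lp_le (lA f Ff) => // n.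
by rewrite dual_norm_ge0 dual_norm_hull.
Qed.

(** For each term [f n] and each rational [r] below its dual norm on [A] choose a
    point of [A] where the modulus of [f n] exceeds [r]. The countable set of
    these points has the same dual norms as [A]. Only positive [r] are asked for,
    since the value 0 may be attained at the point 0, which [A] need not contain. *)
Lemma limited_for_countable A : A !=set0 -> limited_for F q A <->
  forall C, C `<=` A -> C !=set0 -> countable C -> limited_for F q C.
Proof.
move=> A0; split=> [lA C CA C0 _|lA]; first exact: limited_for_sub lA.
split=> // f Ff; have [a0 Aa0] := A0.
have /choice[a aP] (nr : nat * rat) : exists x, A x /\
    ((ratr nr.2)%:E < dual_norm A (f nr.1) ->
     0 < (ratr nr.2 : R)%:E -> (ratr nr.2)%:E < (modulus (f nr.1 x))%:E)%E.
  have [/ereal_sup_gt[_ [x [Ax|->] <-] rx]|] :=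
    boolP ((ratr nr.2)%:E < dual_norm A (f nr.1))%E.
  - by exists x.
  - exists a0; split=> // _ r0; move: rx; rewrite dual0 modulus0.
    by move=> /(lt_trans r0); rewrite ltxx.
  - by move=> _; exists a0.
have [|||_ lC] := lA (range a).
- by move=> _ [nr _ <-]; exact: (aP nr).1.
- by exists (a (0%N, 0)), (0%N, 0).
- exact: card_le_trans (card_image_le _ _) (countableP _).
apply: in_lp_le (lC f Ff) => // n; rewrite dual_norm_ge0 /=.
rewrite leNgt; apply/negP => CA.
have [c fc] := in_lp_fine (lC f Ff).
have /(congr1 (fun u => u n)) /= cE := fc.
have c0 : 0 <= c n by rewrite -lee_fin -cE dual_norm_ge0.
have [_ [y Ay <-]] := ereal_sup_gt CA; rewrite cE lte_fin => cy.
have [r] := rat_in_itvoo cy; rewrite in_itv/= => /andP[cr ry].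
have ra : ((ratr r)%:E < (modulus (f n (a (n, r))))%:E)%E.
  apply: (aP (n, r)).2; last by rewrite lte_fin; exact: le_lt_trans cr.
  apply: (@lt_le_trans _ _ (modulus (f n y))%:E); first by rewrite lte_fin.
  case: Ay => [|->].
    exact: dual_norm_ub.
  by rewrite dual0 modulus0 dual_norm_ge0.
have : ((modulus (f n (a (n, r))))%:E <= (c n)%:E)%E.
  by rewrite -cE; apply: dual_norm_ub; exists (n, r).
by move=> /(lt_le_trans ra); rewrite lte_fin ltNge ltW.
Qed.

(** Boundedness makes each dual norm finite, so it is at most twice the modulus
    of [f n] at some point of [A]. *)
Lemma limited_for_sequences A : A !=set0 -> tvs_bounded A ->
  limited_for F q A <->
  forall (x : nat -> E) f, (forall n, A (x n)) -> F f ->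
    in_lp q (fun n => (modulus (f n (x n)))%:E).
Proof.
move=> A0 bA; split=> [[_ lA] x f Ax Ff|lA].
  apply: in_lp_le (lA f Ff) => // n.
  by rewrite lee_fin modulus_ge0 dual_norm_ub.
split=> // f Ff; have [a0 Aa0] := A0.
have /choice[x xP] n : exists x, A x /\
    (dual_norm A (f n) <= (2 * modulus (f n x))%:E)%E.
  have [M M0 AM] := dual_bounded (f n) bA; have [t t0 Mt] := gt0_real_scalar M0.
  have At : (dual_norm A (f n) <= t%:E)%E.
    apply: dual_norm_le => [|y Ay]; first by rewrite lee_fin ltW.
    by rewrite lee_fin -(@ler_real_scalar _ k) -Mt -norm_modulus AM.
  have := dual_norm_ge0 A (f n).
  rewrite le_eqVlt => /predU1P[<-|d0].
    by exists a0; split=> //; rewrite lee_fin mulr_ge0// modulus_ge0.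
  case eS : (dual_norm A (f n)) At d0 => [S| |]//.
  rewrite lee_fin lte_fin => _ S0.
  have /ereal_sup_gt[_ [x [Ax|->] <-]] : ((S / 2)%:E < dual_norm A (f n))%E.
    by rewrite eS lte_fin ltr_pdivrMr// ltr_pMr// ltr1n.
  - rewrite lte_fin => Sx; exists x; split=> //.
    by rewrite lee_fin mulrC -ler_pdivrMr// ltW.
  - by rewrite dual0 modulus0 lte_fin ltNge ltW// divr_gt0.
have Ax n := (xP n).1.
have fx0 n := modulus_ge0 (f n (x n)).
apply: in_lp_le (in_lpZ q1 fx0 (ltr0n _ 2) (lA x f Ax Ff)) => // n.
by rewrite dual_norm_ge0 (xP n).2.
Qed.

End Class.

Lemma limited_for_le (E : tvsType (scalars R k)) (F G : set (nat -> dual E)) q q'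
    (A : set E) : (1 <= q)%E -> (q <= q')%E -> G `<=` F ->
  limited_for F q A -> limited_for G q' A.
Proof.
move=> q1 qq' GF [A0 lA]; split=> // f /GF/lA; apply: in_lp_monoe => // n.
exact: dual_norm_ge0.
Qed.

(** If [f] is the pull-back of [g] along [T], the dual norm of [g] on the image
    is at most that of [f] on [A]. With the identity map this compares two
    topologies on one space. *)
Lemma limited_for_image (E L : tvsType (scalars R k)) (T : E -> L)
    (F : set (nat -> dual E)) (G : set (nat -> dual L)) q (A : set E) :
  (1 <= q)%E ->
  (forall g, G g -> exists2 f, F f & forall n x, f n x = g n (T x)) ->
  limited_for F q A -> limited_for G q (T @` A).
Proof.
move=> q1 GF [[a Aa] lA]; split; first by exists (T a), a.
move=> g /GF[f Ff fg]; apply: in_lp_le (lA f Ff) => // n.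
rewrite dual_norm_ge0 dual_norm_le ?dual_norm_ge0//.
by move=> _ [x Ax <-]; rewrite -fg; exact: dual_norm_ub.
Qed.

End LimitedFor.

(** * Weak* summable sequences *)

Section NullSequences.
Context {R : realType} {k : scalar_kind}.
Implicit Types (E L : tvsType (scalars R k)) (p q : \bar R).

Definition weakstar_sequences E p : set (nat -> dual E) :=
  [set f | weakstar_summable p f].

Definition equicontinuous_weakstar_sequences E p : set (nat -> dual E) :=
  [set f | equicontinuous_seq f /\ weakstar_summable p f].

Lemma ElimitedE E p q (A : set E) :
  Elimited p q A <-> limited_for (@equicontinuous_weakstar_sequences E p) q A.
Proof.
split=> -[A0 lA]; split=> // f; first by move=> [ef wf]; exact: lA.
by move=> ef wf; exact: lA.
Qed.

Lemma dual_comp_continuous_linear E L (T : {linear E -> L}) (g : dual L) :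
  continuous (T : E -> L) ->
  (fun x => g (T x) : (scalars R k)^o) \in @continuous_linear _ E.
Proof.
move=> cT; apply/asboolP; split; first by move=> a x y; rewrite !linearP.
by move=> x; apply: continuous_comp; [exact: cT|exact: dual_continuous].
Qed.

Definition dual_comp E L (T : {linear E -> L}) (cT : continuous (T : E -> L))
  (g : dual L) : dual E := Dual (dual_comp_continuous_linear g cT).

Lemma weakstar_sequences_comp E L (T : {linear E -> L}) p
    (cT : continuous (T : E -> L)) (g : nat -> dual L) :
  weakstar_sequences p g -> weakstar_sequences p (fun n => dual_comp cT (g n)).
Proof. by move=> wg x; exact: wg. Qed.

Lemma equicontinuous_weakstar_sequences_comp E L (T : {linear E -> L}) p
    (cT : continuous (T : E -> L)) (g : nat -> dual L) :
  equicontinuous_weakstar_sequences p g ->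
  equicontinuous_weakstar_sequences p (fun n => dual_comp cT (g n)).
Proof.
move=> [eg wg]; split; last exact: weakstar_sequences_comp.
by move=> x W /(eg (T x) W) /cT.
Qed.

Lemma weakstar_summable_le E p p' (f : nat -> dual E) :
  (1 <= p')%E -> (p' <= p)%E -> weakstar_summable p' f -> weakstar_summable p f.
Proof.
move=> p1 pp wf x; apply: in_lp_monoe (wf x) => // n.
by rewrite lee_fin modulus_ge0.
Qed.

Lemma seminorm_equicontinuous_seq E (r : E -> R) (f : nat -> dual E) :
  seminorm r -> nbhs 0 [set x | r x <= 1] ->
  (forall n x, modulus (f n x) <= r x) -> equicontinuous_seq f.
Proof.
move=> sr r1 fr; apply: (seminorm_equicontinuous sr r1) => // n.
exact: dual_linear.
Qed.

Lemma modulus_scale E (t : R) (f : dual E) x : 0 <= t ->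
  modulus (((real_scalar t : scalars R k) *: f) x) = t * modulus (f x).
Proof. by move=> t0; rewrite -{2}(modulus_real (k := k) t0) -modulusM. Qed.

(** If every continuous seminorm is bounded on [A], then [A] is absorbed by every
    neighbourhood of 0. Otherwise a seminorm exceeds [2 ^+ n] at some [a n] of
    [A], and the functional that norms [a n], divided by [2 ^+ n], has dual norm
    at least 1; the sequence of these functionals is dominated at [x] by a
    geometric sequence. *)
Lemma Elimited_bounded E p q (A : set E) : (1 <= p)%E -> (1 <= q)%E ->
  Elimited p q A -> tvs_bounded A.
Proof.
move=> p1 q1 [_ lA] U /tvs_seminorm[r [sr r1 rU]].
have [[n rn]|rA] := pselect (exists n, forall x, A x -> r x <= 2 ^+ n).
  exists (real_scalar (2 ^+ n + 1)).
    by rewrite -real_scalar0 ltr_real_scalar ltr_wpDl// exprn_ge0.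
  move=> s; rewrite norm_modulus ler_real_scalar => ns x Ax.
  have n0 : 0 <= 2 ^+ n :> R by rewrite exprn_ge0.
  have s0 : 0 < modulus s by apply: lt_le_trans ns; rewrite ltr_wpDl.
  have sn0 : s != 0 by rewrite -modulus_eq0 gt_eqF.
  exists (s^-1 *: x); last by rewrite scalerA divff// scale1r.
  apply: rU; rewrite /= sr.2 modulusV mulrC ltr_pdivrMr// mul1r.
  apply: le_lt_trans (rn x Ax) _; apply: lt_le_trans ns.
  by rewrite ltrDl.
have /choice[a aP] n : exists a, A a /\ 2 ^+ n < r a.
  apply/not_existsP => an; apply: rA; exists n => x Ax.
  by rewrite leNgt; apply/negP => xn; apply: (an x).
have /choice[chi chiP] n : exists f : dual E,
    (forall x, modulus (f x) <= r x) /\ r (a n) <= modulus (f (a n)).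
  exact: norming_dual.
have c0 n : 0 <= (2 ^+ n)^-1 :> R by rewrite invr_ge0 exprn_ge0.
pose f n : dual E := (real_scalar (2 ^+ n)^-1 : scalars R k) *: chi n.
have fr n x : modulus (f n x) <= r x / 2 ^+ n.
  by rewrite modulus_scale// mulrC ler_wpM2r// (chiP n).1.
have wf : weakstar_summable p f.
  move=> x; apply: in_lp_le (in_lp_geometric p1 (seminorm_ge0 sr x)) => // n.
  by rewrite !lee_fin modulus_ge0 fr.
have ef : equicontinuous_seq f.
  apply: (seminorm_equicontinuous_seq sr r1) => n x.
  apply: le_trans (fr n x) _; rewrite ler_piMr ?(seminorm_ge0 sr)//.
  by rewrite invf_le1 ?exprn_gt0// exprn_ege1// ler1n.
have lf := lA f ef wf; have [u fu] := in_lp_fine lf.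
have u0 n : 0 <= u n.
  by have /(congr1 (@^~ n)) /= un := fu; rewrite -lee_fin -un dual_norm_ge0.
move: lf; rewrite fu => /(in_lp_c0 q1 u0)/in_lp_inftyP-/(_ u0 1 ltr01)[n _].
move=> /(_ n (leqnn n)) /=; have /(congr1 (@^~ n)) /= un := fu.
rewrite -lte_fin -un => /(le_lt_trans (dual_norm_ub (f n) (aP n).1)).
rewrite lte_fin modulus_scale// ltNge -[leLHS](mulVf (x := 2 ^+ n)) ?expf_neq0//.
rewrite ler_wpM2l//; apply: le_trans (chiP n).2; exact/ltW/(aP n).2.
Qed.

(** By the Hausdorff property a nonzero point [x] of [A] lies outside a
    neighbourhood of 0, hence some functional does not vanish at [x]. Its
    multiples by a sequence that is in l_p but not in l_q contradict the
    assumption on [A]. *)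
Lemma Elimited_trivial E p q (A : set E) : hausdorff_space E ->
  (1 <= q)%E -> (q < p)%E -> Elimited p q A -> A = [set 0].
Proof.
move=> hE q1 qp [A0 lA].
suff A00 x : A x -> x = 0.
  apply/seteqP; split=> [x /A00//|_ ->].
  by have [x Ax] := A0; rewrite -(A00 x Ax).
move=> Ax; apply: contrapT => /eqP x0.
have p1 : (1 <= p)%E := le_trans q1 (ltW qp).
have [U U0 Ux] : exists2 U : set E, nbhs 0 U & ~ U x.
  apply: contrapT => nU; move/eqP: x0; apply; apply: hE => V W Vx W0.
  exists x; split; first exact: nbhs_singleton.
  by apply: contrapT => nW; apply: nU; exists W.
have [r [sr r1 rU]] := tvs_seminorm U0.
have rx : 1 <= r x by rewrite leNgt; apply/negP => /rU.
have [chi [chir chix]] := norming_dual x sr r1.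
have cx0 : 0 < modulus (chi x) by apply: lt_le_trans (le_trans rx chix).
have [u u01 [lpu lqu]] := lp_strict q1 qp; apply: lqu.
have u0 n : 0 <= u n by have /andP[] := u01 n.
pose f n : dual E := (real_scalar (u n) : scalars R k) *: chi.
have wf : weakstar_summable p f.
  move=> y; under eq_fun => n do rewrite modulus_scale// mulrC.
  have [->|y0] := eqVneq (modulus (chi y)) 0.
    under eq_fun => n do rewrite mul0r; exact: in_lp_cst0.
  by apply: in_lpZ => //; rewrite lt_neqAle eq_sym y0 modulus_ge0.
have ef : equicontinuous_seq f.
  apply: (seminorm_equicontinuous_seq sr r1) => n y; rewrite modulus_scale//.
  apply: le_trans (chir y); rewrite ler_piMl ?modulus_ge0//.
  by have /andP[] := u01 n.
have cx1 : 0 < (modulus (chi x))^-1 by rewrite invr_gt0.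
have mx0 n := modulus_ge0 (f n x).
apply: in_lp_le (in_lpZ q1 mx0 cx1 _) => //.
  move=> n; rewrite !lee_fin u0 modulus_scale// mulrCA mulVf ?gt_eqF//.
  by rewrite mulr1 lexx.
apply: in_lp_le (lA f ef wf) => // n.
by rewrite lee_fin mx0 dual_norm_ub.
Qed.

End NullSequences.

(** * The permanence properties of limited sets *)

Section Transfer.
Context {R : realType} {k : scalar_kind}.
Implicit Types (E L : tvsType (scalars R k)) (p q : \bar R).

Lemma compatible_dual E (t : lc_topology E) (g : dual E) : compatible t ->
  exists f : dual (retopologized t), forall x, f x = g x.
Proof.
move=> ct.
have Ft : (g : retopologized t -> (scalars R k)^o) \in
    @continuous_linear _ (retopologized t).
  apply/asboolP; split; first exact: (dual_linear g).
  exact: ((ct g).1 (@dual_continuous _ _ g)).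
by exists (Dual Ft).
Qed.

Lemma dual_compatible E (t : lc_topology E) (g : dual (retopologized t)) :
  compatible t -> exists f : dual E, forall x, f x = g x.
Proof.
move=> ct; have lg : linear (g : E -> (scalars R k)^o) := dual_linear g.
pose gL := GRing.isLinear.Build (scalars R k) E (scalars R k)^o _
  (g : E -> (scalars R k)^o) lg.
pose gl : {linear E -> (scalars R k)^o} := HB.pack (g : E -> (scalars R k)^o) gL.
have F : (g : E -> (scalars R k)^o) \in @continuous_linear _ E.
  apply/asboolP; split; first exact: lg.
  exact: ((ct gl).2 (@dual_continuous _ _ g)).
by exists (Dual F).
Qed.

(** Compatible topologies have the same functionals, and weak* summability
    involves the topology through the functionals only; the identity map
    transports the sequences both ways. *)
Lemma limited_compatible E (t : lc_topology E) p q (A : set E) : (1 <= q)%E ->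
  compatible t -> @limited R k (retopologized t) p q A <-> limited p q A.
Proof.
move=> q1 ct; split=> lA; rewrite -[A]image_id.
  apply: (@limited_for_image _ _ (retopologized t) E id
    (@weakstar_sequences _ _ (retopologized t) p)
    (@weakstar_sequences _ _ E p) q A q1 _ lA) => g wg.
  have /choice[f fg] n := compatible_dual (g n) ct.
  exists f => // x; under eq_fun => n do rewrite fg; exact: wg.
apply: (@limited_for_image _ _ E (retopologized t) id
  (@weakstar_sequences _ _ E p)
  (@weakstar_sequences _ _ (retopologized t) p) q A q1 _ lA) => g wg.
have /choice[f fg] n := dual_compatible (g n) ct.
exists f => // x; under eq_fun => n do rewrite fg; exact: wg.
Qed.

Lemma dual_norm_supE E (A : set E) (f : nat -> dual E) : A !=set0 ->
  (fun n => ereal_sup [set (modulus (f n a))%:E | a in A]) =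
  (fun n => dual_norm A (f n)).
Proof. by move=> A0; apply/funext => n; exact: dual_norm_sup. Qed.

Lemma Vstar_setE E p q (A : set E) : Vstar_set p q A <->
  limited_for [set f : nat -> strong_dual E | weakly_summable p f] q A.
Proof.
split=> -[A0 lA]; split=> // f /lA;
  by rewrite (dual_norm_supE f A0).
Qed.

Lemma EVstar_setE E p q (A : set E) : EVstar_set p q A <->
  limited_for [set f : nat -> strong_dual E |
    equicontinuous_seq f /\ weakly_summable p f] q A.
Proof.
split=> -[A0 lA]; split=> // f.
  by move=> [ef wf]; rewrite -(dual_norm_supE f A0); exact: lA.
by move=> ef wf; rewrite (dual_norm_supE f A0); exact: lA.
Qed.

Lemma weakly_summable_weakstar E p (f : nat -> strong_dual E) :
  weakly_summable p f -> weakstar_summable p f.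
Proof. by move=> wf x; exact: (wf (canonical_map x)). Qed.

(** Semi-reflexivity says that all functionals on the strong dual are
    evaluations, which weak* summability controls. *)
Lemma semi_reflexive_weakly_summable E p (f : nat -> strong_dual E) :
  semi_reflexive E -> weakstar_summable p f -> weakly_summable p f.
Proof. by move=> [h _ hK] wf phi; rewrite -[phi]hK; exact: (wf (h phi)). Qed.

Lemma limited_V_set E p q (B : set (strong_dual E)) :
  limited p q B -> V_set p q B.
Proof.
move=> [B0 lB]; split=> // x wx.
have := lB (fun n => canonical_map (x n)) (fun f => wx f).
by rewrite -(dual_norm_supE (fun n => canonical_map (x n)) B0).
Qed.

(** The dual norm on a finite set is at most the sum of the moduli at its
    points. *)
Lemma limited_finite E p q (A : set E) : (1 <= p)%E -> (p <= q)%E ->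
  A !=set0 -> finite_set A -> limited p q A.
Proof.
move=> p1 pq A0 /finite_seqP[s As]; split=> // f wf.
have m0 (x : E) n : (0 <= (modulus (f n x))%:E)%E by rewrite lee_fin modulus_ge0.
have q1 := le_trans p1 pq.
have := in_lp_sum s q1 m0 (fun x => in_lp_monoe p1 pq (m0 x) (wf x)).
apply: in_lp_le => // n; rewrite dual_norm_ge0 dual_norm_le//.
  exact: sume_ge0.
by move=> x; rewrite As /= => xs; rewrite (big_rem x xs)/= leeDl// sume_ge0.
Qed.

Lemma limited_image E L p q (T : {linear E -> L}) (A : set E) : (1 <= q)%E ->
  continuous (T : E -> L) ->
  (limited p q A -> limited p q (T @` A)) /\
  (Elimited p q A -> Elimited p q (T @` A)).
Proof.
move=> q1 cT; split=> [|/ElimitedE lA].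
  apply: limited_for_image => // g wg; exists (fun n => dual_comp cT (g n)) => //.
  exact: weakstar_sequences_comp.
apply/ElimitedE; apply: limited_for_image lA => // g wg.
exists (fun n => dual_comp cT (g n)) => //.
exact: equicontinuous_weakstar_sequences_comp.
Qed.

End Transfer.

Theorem lemma3p1 (R : realType) (k : scalar_kind) (p q : \bar R)
    (E : tvsType (scalars R k)) :
  (1 <= p)%E -> (1 <= q)%E -> hausdorff_space E ->
  (* (i) *)
  ((forall A : set E, limited p q A -> Elimited p q A) /\
   (p_barrelled E p -> forall A : set E, Elimited p q A -> limited p q A)) /\
  (* (ii) *)
  (forall A : set E, Elimited p q A -> tvs_bounded A) /\
  (* (iii) *)
  ((forall A B : set E, B `<=` A -> B !=set0 ->
     (limited p q A -> limited p q B) /\ (Elimited p q A -> Elimited p q B)) /\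
   (forall (n : nat) (A : 'I_n.+1 -> set E),
     ((forall i, limited p q (A i)) ->
        limited p q (\bigcup_i A i) /\
        limited p q [set \sum_i a i | a in [set a | forall i, A i (a i)]]) /\
     ((forall i, Elimited p q (A i)) ->
        Elimited p q (\bigcup_i A i) /\
        Elimited p q [set \sum_i a i | a in [set a | forall i, A i (a i)]])) /\
   (forall A : set E,
     (limited p q A -> limited p q (closed_absolutely_convex_hull A)) /\
     (Elimited p q A -> Elimited p q (closed_absolutely_convex_hull A)))) /\
  (* (iv) *)
  ((forall (L : tvsType (scalars R k)) (T : {linear E -> L}) (A : set E),
     hausdorff_space L -> continuous (T : E -> L) ->
     (limited p q A -> limited p q (T @` A)) /\
     (Elimited p q A -> Elimited p q (T @` A))) /\
   (forall (H : submodClosed E) (A : set (subspace_tvs H)),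
     (limited p q A -> limited p q ((val : subspace_tvs H -> E) @` A)) /\
     (Elimited p q A -> Elimited p q ((val : subspace_tvs H -> E) @` A)))) /\
  (* (v) *)
  (forall A : set E, A !=set0 ->
     (limited p q A <->
      forall C : set E, C `<=` A -> C !=set0 -> countable C ->
        limited p q C) /\
     (Elimited p q A <->
      forall C : set E, C `<=` A -> C !=set0 -> countable C ->
        Elimited p q C)) /\
  (* (vi) *)
  ((forall p' q' : \bar R, (1 <= p')%E -> (1 <= q')%E ->
     (p' <= p)%E -> (q <= q')%E -> forall A : set E,
     (limited p q A -> limited p' q' A) /\
     (Elimited p q A -> Elimited p' q' A)) /\
   (forall A : set E,
     (limited p q A -> limited 1%E +oo%E A) /\
     (Elimited p q A -> Elimited 1%E +oo%E A))) /\
  (* (vii) *)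
  (forall t : lc_topology E, hausdorff_space (retopologized t) ->
     compatible t ->
     forall A : set E,
       @limited R k (retopologized t) p q A <-> limited p q A) /\
  (* (viii) *)
  ((forall A : set E,
     (limited p q A -> Vstar_set p q A) /\
     (Elimited p q A -> EVstar_set p q A)) /\
   (semi_reflexive E -> forall A : set E,
     (Vstar_set p q A -> limited p q A) /\
     (EVstar_set p q A -> Elimited p q A))) /\
  (* (ix) *)
  (forall B : set (strong_dual E), limited p q B -> V_set p q B) /\
  (* (x) *)
  ((q < p)%E -> forall A : set E, Elimited p q A -> A = [set 0]) /\
  (* (xi) *)
  ((p <= q)%E -> forall A : set E, A !=set0 -> finite_set A -> limited p q A) /\
  (* (xii) *)
  (forall A : set E, A !=set0 -> tvs_bounded A ->
     (limited p q A <->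
      forall (x : nat -> E) (f : nat -> dual E),
        (forall n, A (x n)) -> weakstar_summable p f ->
        in_lp q (fun n => (modulus (f n (x n)))%:E)) /\
     (Elimited p q A <->
      forall (x : nat -> E) (f : nat -> dual E),
        (forall n, A (x n)) -> equicontinuous_seq f -> weakstar_summable p f ->
        in_lp q (fun n => (modulus (f n (x n)))%:E))).
Proof.
move=> p1 q1 hE; split; last split; last split; last split;
  last split; last split; last split; last split; last split; last split;
  last split.
- split=> [A [A0 lA]|bE A [A0 lA]]; split=> // f; first by move=> _; exact: lA.
  by move=> wf; apply: lA => //; exact: bE.
- by move=> A; exact: Elimited_bounded.
- split; [|split].
  + move=> A B BA B0; split=> [|/ElimitedE lA]; first exact: limited_for_sub.
    by apply/ElimitedE; exact: limited_for_sub lA.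
  + move=> n A; split=> [lA|lA].
      by split; [exact: limited_for_bigcup|exact: limited_for_sum].
    have {}lA i := (ElimitedE p q (A i)).1 (lA i).
    by split; apply/ElimitedE;
      [exact: limited_for_bigcup|exact: limited_for_sum].
  + move=> A; split=> [|/ElimitedE lA]; first exact: limited_for_hull.
    by apply/ElimitedE; exact: limited_for_hull.
- split; first by move=> L T A _; exact: limited_image.
  move=> H A.
  pose T : {linear subspace_tvs H -> E} := val.
  have cT : continuous (T : subspace_tvs H -> E) by exact: initial_continuous.
  exact: (limited_image p A q1 cT).
- move=> A A0; split; first exact: limited_for_countable.
  split=> [/ElimitedE lA C CA C0 cC|lA]; apply/ElimitedE.
    exact: (limited_for_countable _ q1 A0).1 lA C CA C0 cC.
  apply/(limited_for_countable _ q1 A0) => C CA C0 cC.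
  by apply/ElimitedE; exact: lA.
- have le p' q' : (1 <= p')%E -> (p' <= p)%E -> (q <= q')%E -> forall A : set E,
      (limited p q A -> limited p' q' A) /\
      (Elimited p q A -> Elimited p' q' A).
    move=> p'1 p'p qq' A; split=> [|/ElimitedE lA].
      by apply: limited_for_le => // f; exact: weakstar_summable_le.
    apply/ElimitedE; apply: limited_for_le lA => // f [ef wf]; split=> //.
    exact: weakstar_summable_le wf.
  split; first by move=> p' q' p'1 _; exact: le.
  by apply: le => //; rewrite leey.
- by move=> t _ ct A; exact: limited_compatible.
- split=> [A|rE A].
    split=> [lA|/ElimitedE lA].
      apply/Vstar_setE; apply: limited_for_le lA => // f.
      exact: weakly_summable_weakstar.
    apply/EVstar_setE; apply: limited_for_le lA => // f [ef wf]; split=> //.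
    exact: weakly_summable_weakstar.
  split=> [/Vstar_setE lA|/EVstar_setE lA].
    apply: limited_for_le lA => // f; exact: semi_reflexive_weakly_summable.
  apply/ElimitedE; apply: limited_for_le lA => // f [ef wf]; split=> //.
  exact: semi_reflexive_weakly_summable.
- by move=> B; exact: limited_V_set.
- by move=> qp A; exact: Elimited_trivial.
- by move=> pq A; exact: limited_finite.
- move=> A A0 bA; split; first exact: limited_for_sequences.
  split=> [/ElimitedE lA x f Ax ef wf|lA].
    exact: (limited_for_sequences _ q1 A0 bA).1 lA x f Ax (conj ef wf).
  apply/ElimitedE/(limited_for_sequences _ q1 A0 bA) => x f Ax [ef wf].
  exact: lA.
Qed.
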